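(* Let $K$ be a self-similar set in $\mathbb{R}^{d}$ satisfying the open set condition (OSC). Then the following assertions are equivalent: (i) $\dim_M K=d$; (ii) $s_{d-1}(K)<\dim_M K$; (iii) $K$ is locally $d$-flat.
   Context: **Self-similar sets.** Let $N\ge 2$ and let $S_1,\dots,S_N:\mathbb{R}^d\to\mathbb{R}^d$ be contracting similarities with ratios $r_i\in(0,1)$. The self-similar set generated by $\{S_1,\dots,S_N\}$ is the unique nonempty compact set $K$ with $K=\bigcup_i S_iK$. It satisfies OSC if there is a nonempty open set $O$ with $\bigcup_i S_iO\subset O$ and $S_iO\cap S_jO=\emptyset$ for $i\ne j$. $\dim_M$ denotes Minkowski (box) dimension (it exists for such $K$). **Local flatness.** $K\subset\mathbb{R}^d$ is locally $d$-flat if for every $x\in K$ and $\varepsilon>0$ there is a closed cube $C\subset B(x,\varepsilon)$ such that $C^\circ\cap K\neq\emptyset$ and $C\cap K$ is similar to $[0,1]^d$. Here $B(x,\varepsilon)$ is the closed ball. **Scaling exponent.** For bounded $F\subset\mathbb{R}^d$ let $F_\varepsilon=\{y\in\mathbb{R}^d:\mathrm{dist}(y,F)\le\varepsilon\}$ and $C_{d-1}^{\mathrm{var}}(F_\varepsilon)=\tfrac12\mathcal H^{d-1}(\partial F_\varepsilon)$. Then $s_{d-1}(F):=\inf\{s\ge0:\ \mathrm{ess\,lim}_{\varepsilon\to0}\,\varepsilon^{s-(d-1)}C_{d-1}^{\mathrm{var}}(F_\varepsilon)=0\}$, where the essential limit means the limit after discarding a Lebesgue null set of $\varepsilon$'s.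 *)

(* Defs.v *)
From HB Require Import structures.
From mathcomp Require Import all_boot all_order all_algebra.
From mathcomp Require Import all_classical all_reals all_analysis.

Set Implicit Arguments.
Unset Strict Implicit.
Unset Printing Implicit Defensive.

Import Order.TTheory GRing.Theory Num.Theory.
Import numFieldNormedType.Exports.

Local Open Scope classical_set_scope.
Local Open Scope ring_scope.

(* R^d is ['rV[R]_d].  Its library norm is the sup norm, so
    every metric notion below goes through the Euclidean norm [enorm]; purely
    topological notions (open, compact, closure, interior) are the library's,
    the two norms inducing the same topology. *)

Section Euclidean.
Variables (R : realType) (d : nat).
Implicit Types (x y : 'rV[R]_d) (A B F C : set 'rV[R]_d).

Definition enorm x : R := Num.sqrt (\sum_(i < d) x ord0 i ^+ 2).

Definition eball x (e : R) : set 'rV[R]_d := [set y | enorm (y - x) <= e].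

(* [0] is added so that the empty set has diameter 0. *)
Definition ediam A : \bar R :=
  ereal_sup (0%E |` [set (enorm (x - y))%:E | x in A & y in A]).

Definition edist y F : \bar R := ereal_inf [set (enorm (y - x))%:E | x in F].

Definition parallel_set F (e : R) : set 'rV[R]_d :=
  [set y | (edist y F <= e%:E)%E].

Definition boundary A : set 'rV[R]_d := closure A `\` A°.

Definition similarity (r : R) (T : 'rV[R]_d -> 'rV[R]_d) : Prop :=
  forall x y, enorm (T x - T y) = r * enorm (x - y).

Definition similar_sets A B : Prop :=
  exists r : R, exists T : 'rV[R]_d -> 'rV[R]_d,
    [/\ 0 < r, similarity r T & T @` A = B].

Definition unit_cube : set 'rV[R]_d := [set x | forall i, 0 <= x ord0 i <= 1].

(* Nondegenerate, of arbitrary orientation. *)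
Definition closed_cube C : Prop := similar_sets unit_cube C.

Definition locally_flat (K : set 'rV[R]_d) : Prop :=
  forall x, K x -> forall e : R, 0 < e ->
    exists C, [/\ closed_cube C, C `<=` eball x e,
                  C° `&` K !=set0 & similar_sets (C `&` K) unit_cube].

End Euclidean.

Section IteratedFunctionSystems.
Variables (R : realType) (d N : nat).
Implicit Types (S : 'I_N -> 'rV[R]_d -> 'rV[R]_d) (K : set 'rV[R]_d).

Definition contracting_similarity (T : 'rV[R]_d -> 'rV[R]_d) : Prop :=
  exists r : R, 0 < r < 1 /\ similarity r T.

(* [K] is the self-similar set generated by [S]; by Hutchinson's theorem these
   conditions determine [K]. *)
Definition self_similar_set S K : Prop :=
  [/\ K !=set0, compact K & K = \bigcup_i (S i @` K)].

Definition open_set_condition S : Prop :=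
  exists V : set 'rV[R]_d,
    [/\ V !=set0, open V,
        \bigcup_i (S i @` V) `<=` V &
        forall i j, i != j -> (S i @` V) `&` (S j @` V) = set0].

End IteratedFunctionSystems.

Section MinkowskiDimension.
Variables (R : realType) (d : nat).

(* Least number of sets of diameter at most [delta] needed to cover [F]; the
   infimum, taken in [R], is over a nonempty set whenever [F] is bounded. *)
Definition covering_number (F : set 'rV[R]_d) (delta : R) : R :=
  inf [set (n%:R : R) | n in [set n : nat | exists U : 'I_n -> set 'rV[R]_d,
         (forall i, (ediam (U i) <= delta%:E)%E) /\
         F `<=` \bigcup_i U i]].

Definition minkowski_dim (F : set 'rV[R]_d) : R :=
  lim (ln (covering_number F delta) / - ln delta @[delta --> 0^'+]).

End MinkowskiDimension.

(* Volume of the Euclidean unit ball of R^m, by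
   omega_(m+2) = 2 pi / (m+2) * omega_m. *)
Fixpoint unit_ball_volume (R : realType) (m : nat) : R :=
  match m with
  | 0 => 1
  | 1 => 2
  | (k.+1 as k1).+1 =>
      2 * pi / k1.+1%:R * unit_ball_volume R k
  end.

Section HausdorffMeasure.
Variables (R : realType) (d m : nat).
Local Open Scope ereal_scope.

(* The [set0] case only matters for [m = 0], where [ediam set0 ^+ 0 = 1]. *)
Definition hausdorff_gauge (A : set 'rV[R]_d) : \bar R :=
  if A == set0 then 0 else ediam A ^+ m.

Definition hausdorff_premeasure (delta : R) (A : set 'rV[R]_d) : \bar R :=
  ereal_inf [set \sum_(0 <= k <oo) hausdorff_gauge (U k) |
    U in [set U : (set 'rV[R]_d)^nat |
           (forall k, ediam (U k) <= delta%:E) /\ A `<=` \bigcup_k U k]].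

(* Normalised so that H^d is Lebesgue measure on R^d. *)
Definition hausdorff_measure (A : set 'rV[R]_d) : \bar R :=
  (unit_ball_volume R m / 2 ^+ m)%:E *
  ereal_sup [set hausdorff_premeasure delta A |
    delta in [set delta : R | (0 < delta)%R]].

End HausdorffMeasure.

Section ScalingExponent.
Variables (R : realType) (d : nat).
Local Open Scope ereal_scope.

(* C_{d-1}^var(F_e), for [0 < d]. *)
Definition curvature_var (F : set 'rV[R]_d) (e : R) : \bar R :=
  (2^-1)%:E * hausdorff_measure d.-1 (boundary (parallel_set F e)).

Definition ess_cvg_at_right0 (f : R -> \bar R) (l : \bar R) : Prop :=
  exists2 N : set R, lebesgue_measure.-negligible N &
    f e @[e --> within (~` N) (0%R : R)^'+] --> l.

Definition scaling_exponent (F : set 'rV[R]_d) : \bar R :=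
  ereal_inf [set s%:E | s in [set s : R | (0 <= s)%R /\
    ess_cvg_at_right0
      (fun e => (e `^ (s - (d%:R - 1)))%:E * curvature_var F e) 0]].

End ScalingExponent.

(* Main.v *)
(** Let [D] solve [sum_i r_i^D = 1]. The open set condition gives [D <= d] and
    identifies [D] with the Minkowski dimension of [K]; all volume estimates are
    made by counting lattice points in cubes.

    If [D = d], the images of the open set [V] exhaust its volume, so [V] is
    contained in [K]. Small cubes inside cylinders then show that [K] is locally
    flat, and the topological boundary of [K], which misses every cylinder lying
    in the interior of [K], is covered by copies of itself whose dimension [t] is
    less than [d]. A point of the boundary of [K_e] is at distance exactly [e]
    from the boundary of [K], and within a ball of radius [e] such points form
    boundedly many Lipschitz graphs. So H^(d-1) of the boundary of [K_e] is
    O(e^(d-1-t)).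

    If [D < d], then [K] is porous: within distance [L e] of each of its points
    there is a point at distance more than [2 e] from [K]. The segments joining
    the two neighbourhoods cross the boundary of [K_e], so that for every small
    [e] its H^(d-1) measure is at least [c e^(d-1-D)]; hence the scaling exponent
    is at least [D]. Finally, local flatness puts a cube into [K] and forces
    [D = d]. *)

Require Import Defs.
From HB Require Import structures.
From mathcomp Require Import all_boot all_order all_algebra.
From mathcomp Require Import all_classical all_reals all_analysis.
From mathcomp Require Import ring lra.

Set Implicit Arguments.
Unset Strict Implicit.
Unset Printing Implicit Defensive.

Import Order.TTheory GRing.Theory Num.Theory.
Import numFieldNormedType.Exports.

Local Open Scope classical_set_scope.
Local Open Scope ring_scope.

(** * Euclidean norm *)

(** Cylinders of [K] may overlap; the open set condition only separates the images of [V]. Every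
    count of cylinders therefore goes through the disjoint images of a ball in [V], and cylinders
    close to a given point are tied to those images because [K] and [V] lie in a common ball.
    Lattice counting replaces volumes by inequalities that lose a factor depending on [d]. This loss
    is harmless: each inequality is used for all word lengths or for all scales at once, so that a
    constant disappears against a power or a diverging count. The lower bound on the measure of the
    boundary must hold against arbitrary countable covers. Projection to dimension [d - 1] turns
    such a cover into one of a cube, and compactness makes that cover finite after a thickening of
    small total cost. The upper bound needs covers by arbitrarily small sets. Bounded diameter alone
    gives no such bound; the cone condition on points at distance exactly [e] does. Both bounds hold
    for every small [e], not for almost every one, so the null set in the essential limit can be
    taken empty in one direction and cannot contain an interval in the other. *)

Section EuclideanNorm.
Variables (R : realType) (d : nat).
Implicit Types (x y : 'rV[R]_d).

Lemma enorm_ge0 x : 0 <= enorm x.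
Proof. exact: sqrtr_ge0. Qed.

Lemma sumsq_ge0 x : 0 <= \sum_(i < d) x ord0 i ^+ 2.
Proof. by apply: sumr_ge0 => i _; exact: sqr_ge0. Qed.

Lemma sqr_enorm x : enorm x ^+ 2 = \sum_(i < d) x ord0 i ^+ 2.
Proof. by rewrite sqr_sqrtr// sumsq_ge0. Qed.

Lemma enorm0 : enorm (0 : 'rV[R]_d) = 0.
Proof. by rewrite /enorm big1 ?sqrtr0// => i _; rewrite mxE expr0n. Qed.

Lemma enormZ (a : R) x : enorm (a *: x) = `|a| * enorm x.
Proof.
rewrite /enorm -sqrtr_sqr -sqrtrM ?sqr_ge0//; congr (Num.sqrt _).
by rewrite mulr_sumr; apply: eq_bigr => i _; rewrite mxE exprMn.
Qed.

Lemma enormN x : enorm (- x) = enorm x.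
Proof. by rewrite -scaleN1r enormZ normrN normr1 mul1r. Qed.

Lemma enormC x y : enorm (x - y) = enorm (y - x).
Proof. by rewrite -enormN opprB. Qed.

Lemma enorm_coord x i : `|x ord0 i| <= enorm x.
Proof.
rewrite -sqrtr_sqr; apply: ler_wsqrtr.
by rewrite (bigD1 i)//= lerDl; apply: sumr_ge0 => j _; exact: sqr_ge0.
Qed.

Lemma enorm_eq0 x : enorm x = 0 -> x = 0.
Proof.
move=> x0; apply/rowP => i; rewrite mxE; apply/eqP; rewrite -normr_le0.
by rewrite (le_trans (enorm_coord x i))// x0.
Qed.

Lemma enorm_le_coord x (h : R) : 0 <= h -> (forall i, `|x ord0 i| <= h) ->
  enorm x <= d%:R * h.
Proof.
move=> h0 xh; rewrite -(@ler_pXn2r _ 2)// ?nnegrE ?enorm_ge0 ?mulr_ge0//.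
rewrite sqr_enorm; apply: (@le_trans _ _ (\sum_(i < d) h ^+ 2)).
  by apply: ler_sum => i _; rewrite -real_normK ?num_real// lerXn2r ?nnegrE.
rewrite sumr_const card_ord exprMn -[leLHS]mulr_natl ler_wpM2r ?sqr_ge0//.
by rewrite -natrX ler_nat; case: d => // n; rewrite -mulnn leq_pmulr.
Qed.

Lemma cauchy_schwarz x y :
  (\sum_(i < d) x ord0 i * y ord0 i) <= enorm x * enorm y.
Proof.
have [y0|y0] := eqVneq (enorm y) 0.
  rewrite y0 mulr0 (enorm_eq0 y0) big1// => i _; by rewrite mxE mulr0.
have expand (p : R) : \sum_(i < d) (enorm y ^+ 2 * x ord0 i - p * y ord0 i) ^+ 2 =
    enorm y ^+ 4 * enorm x ^+ 2 -
    2 * p * enorm y ^+ 2 * (\sum_(i < d) x ord0 i * y ord0 i) + p ^+ 2 * enorm y ^+ 2.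
  rewrite (sqr_enorm x) {3}(sqr_enorm y) !mulr_sumr -sumrB -big_split/=; apply: eq_bigr => i _.
  ring.
set P := \sum_(i < d) _.
have [P0|P0] := ltP P 0.
  by rewrite (le_trans (ltW P0))// mulr_ge0 ?enorm_ge0.
rewrite -(@ler_pXn2r _ 2)// ?nnegrE ?mulr_ge0 ?enorm_ge0//.
have : 0 <= \sum_(i < d) (enorm y ^+ 2 * x ord0 i - P * y ord0 i) ^+ 2.
  by apply: sumr_ge0 => i _; exact: sqr_ge0.
rewrite {}expand -/P; have -> : enorm y ^+ 4 * enorm x ^+ 2 - 2 * P * enorm y ^+ 2 * P +
  P ^+ 2 * enorm y ^+ 2 = enorm y ^+ 2 * ((enorm x * enorm y) ^+ 2 - P ^+ 2) by ring.
by rewrite pmulr_rge0 ?subr_ge0// exprn_gt0// lt_neqAle eq_sym y0 enorm_ge0.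
Qed.

Lemma sqr_enormD x y : enorm (x + y) ^+ 2 =
  enorm x ^+ 2 + 2 * (\sum_(i < d) x ord0 i * y ord0 i) + enorm y ^+ 2.
Proof.
rewrite !sqr_enorm mulr_sumr -!big_split/=; apply: eq_bigr => i _.
by rewrite mxE; ring.
Qed.

Lemma enormD x y : enorm (x + y) <= enorm x + enorm y.
Proof.
rewrite -(@ler_pXn2r _ 2)// ?nnegrE ?addr_ge0 ?enorm_ge0//.
rewrite sqr_enormD; have := cauchy_schwarz x y; nra.
Qed.

Lemma enormB_trans x y z : enorm (x - z) <= enorm (x - y) + enorm (y - z).
Proof. by rewrite (le_trans _ (enormD _ _))// addrA subrK. Qed.

Lemma nbhs_enorm x (A : set 'rV[R]_d) :
  nbhs x A <-> exists2 a : R, 0 < a & forall y, enorm (y - x) <= a -> A y.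
Proof.
split=> [/nbhs_ballP[e/= e0 xeA]|[a a0 aA]].
  exists (e / 2); first by rewrite divr_gt0.
  move=> y yx; apply: xeA; split => // i j; rewrite ord1 -ball_normE/=.
  rewrite distrC; have := enorm_coord (y - x) j; rewrite !mxE => h.
  by rewrite (le_lt_trans h)// (le_lt_trans yx)// ltr_pdivrMr// ltr_pMr// ltr1n.
(* Dividing by [d.+1] rather than [d] keeps the radius positive when [d = 0]. *)
apply/nbhs_ballP; exists (a / d.+1%:R); first by rewrite /= divr_gt0.
move=> y [_ /= xy]; apply: aA; apply: (@le_trans _ _ (d%:R * (a / d.+1%:R))).
  apply: enorm_le_coord => [|i]; first by rewrite divr_ge0// ltW.
  have := xy ord0 i; rewrite -ball_normE/= distrC !mxE => /ltW; exact.
by rewrite mulrCA ler_piMr ?(ltW a0)// ler_pdivrMr// mul1r ler_nat.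
Qed.

Lemma closure_enorm (A : set 'rV[R]_d) x :
  closure A x <-> forall a : R, 0 < a -> exists2 y, A y & enorm (y - x) <= a.
Proof.
split=> [cA a a0|h B /nbhs_enorm[a a0 aB]].
  have /cA [y [Ay /= xy]] : nbhs x [set y | enorm (y - x) <= a].
    by apply/nbhs_enorm; exists a.
  by exists y.
by have [y Ay yx] := h _ a0; exists y; split => //; exact: aB.
Qed.

End EuclideanNorm.

(** * Lattice-point counting *)

Lemma card_le_width n q (P : pred 'I_n) :
  (forall k k' : 'I_n, P k -> P k' -> (k' < k + q)%N) -> (#|P| <= q)%N.
Proof.
move=> h; have [k0 Pk0|P0] := pickP P; last by rewrite eq_card0.
case: (arg_minnP (fun k : 'I_n => k : nat) Pk0) => k1 Pk1 k1min.
rewrite cardE -(size_map val) -(size_iota k1 q); apply: uniq_leq_size.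
  by rewrite map_inj_uniq ?enum_uniq//; exact: val_inj.
move=> _ /mapP[k + ->]; rewrite mem_enum => Pk.
by rewrite mem_iota k1min//= h.
Qed.

Lemma card_ge_interval n lo q (P : pred 'I_n) : (lo + q <= n)%N ->
  (forall k : 'I_n, (lo <= k < lo + q)%N -> P k) -> (q <= #|P|)%N.
Proof.
move=> lon h; rewrite cardE -(size_map val) -{1}(size_iota lo q).
apply: uniq_leq_size; first exact: iota_uniq.
move=> k; rewrite mem_iota => /andP[lok klo].
have kn : (k < n)%N by rewrite (leq_trans klo).
by apply/mapP; exists (Ordinal kn) => //; rewrite mem_enum; apply: h; rewrite lok.
Qed.

Lemma card_family_le (I J : finType) (F : I -> pred J) q :
  (forall i, #|F i| <= q)%N -> (#|family F| <= q ^ #|I|)%N.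
Proof.
move=> h; rewrite card_family [X in (_ <= _ ^ X)%N]cardE /image_mem; elim: (enum I) => //= i s ih.
by rewrite expnS leq_mul.
Qed.

Lemma card_family_ge (I J : finType) (F : I -> pred J) q :
  (forall i, q <= #|F i|)%N -> (q ^ #|I| <= #|family F|)%N.
Proof.
move=> h; rewrite card_family [X in (_ ^ X <= _)%N]cardE /image_mem; elim: (enum I) => //= i s ih.
by rewrite expnS leq_mul.
Qed.

Lemma sum_card_cover (T : eqType) (J : finType) (s : seq T) (A : T -> {set J}) :
  (forall f, exists2 t, t \in s & f \in A t) -> (#|J| <= \sum_(t <- s) #|A t|)%N.
Proof.
move=> h; rewrite -sum1_card.
under [leqRHS]eq_bigr => t _ do rewrite -sum1_card.
under [leqRHS]eq_bigr => t _ do rewrite big_mkcond/=.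
rewrite exchange_big/=; apply: leq_sum => f _.
have [t ts ft] := h f; rewrite (perm_big _ (perm_to_rem ts)) big_cons ft.
exact: leq_addr.
Qed.

Lemma sum_card_disjoint (T : eqType) (J : finType) (s : seq T) (A : T -> {set J}) :
  uniq s -> {in s &, forall t t', forall f, f \in A t -> f \in A t' -> t = t'} ->
  (\sum_(t <- s) #|A t| <= #|J|)%N.
Proof.
move=> us h; rewrite -[leqRHS]sum1_card.
under [leqLHS]eq_bigr => t _ do rewrite -sum1_card.
under [leqLHS]eq_bigr => t _ do rewrite big_mkcond/=.
rewrite exchange_big/=; apply: leq_sum => f _.
have [/hasP[t ts ft]|/hasPn hn] := boolP (has (fun t => f \in A t) s); last first.
  by rewrite big_seq big1// => t /hn /negbTE ->.
rewrite (perm_big _ (perm_to_rem ts)) big_cons ft big_seq big1//.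
move=> t'; rewrite mem_rem_uniq// inE => /andP[tt' t's].
by case: ifPn => // ft'; rewrite (h _ _ t's ts _ ft' ft) eqxx in tt'.
Qed.

Section LatticeCounting.
Variables (R : realType).

Lemma seq_lower_bound (T : eqType) (s : seq T) (f : T -> R) :
  (forall t, t \in s -> 0 < f t) ->
  exists2 e, 0 < e & forall t, t \in s -> e <= f t.
Proof.
elim: s => [|t s ih] h; first by exists 1.
have [|e e0 he] := ih; first by move=> u us; apply: h; rewrite inE us orbT.
exists (Num.min e (f t)); first by rewrite lt_min e0 h ?inE ?eqxx.
move=> u; rewrite inE => /orP[/eqP->|us]; first by rewrite ge_min lexx orbT.
by rewrite ge_min he.
Qed.

(** A volume comparison by counting. Put a grid of [n ^ m] points into the cube, fine enough that
    [n * rho t / side >= 1] for all [t]. Along each axis [U t] meets at most [n * rho t / side + 1]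
    grid indices, and the factor 2 absorbs the extra 1. *)
Lemma covering_sum m (T : eqType) (s : seq T) (U : T -> set 'rV[R]_m)
    (rho : T -> R) (a : 'rV[R]_m) (side : R) :
  0 < side -> (forall t, t \in s -> 0 < rho t) ->
  (forall t, t \in s -> forall x y, U t x -> U t y ->
     forall j, `|x ord0 j - y ord0 j| <= rho t) ->
  (forall x : 'rV[R]_m, (forall j, a ord0 j <= x ord0 j <= a ord0 j + side) ->
     exists2 t, t \in s & U t x) ->
  side ^+ m <= \sum_(t <- s) (2 * rho t) ^+ m.
Proof.
move=> side0 rho0 hU hcov.
have [e e0 erho] := seq_lower_bound rho0.
pose n := (Num.truncn (side / e)).+1.
have n0 : 0 < n%:R :> R by rewrite ltr0n.
have nrho t : t \in s -> 1 <= n%:R * rho t / side.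
  move=> ts; rewrite ler_pdivlMr// mul1r.
  apply: le_trans (_ : n%:R * e <= _); last by rewrite ler_pM2l ?erho.
  by rewrite -ler_pdivrMr// ltW// truncnS_gt.
pose p (f : {ffun 'I_m -> 'I_n}) : 'rV[R]_m :=
  \row_j (a ord0 j + side * (f j)%:R / n%:R).
pose A t := [set f | `[< U t (p f) >]]%SET.
have AU u f : f \in A u -> U u (p f) by rewrite inE => /asboolP.
have cov : (#|{ffun 'I_m -> 'I_n}| <= \sum_(t <- s) #|A t|)%N.
  apply: sum_card_cover => f; have [|t ts Ut] := hcov (p f).
    move=> j; rewrite mxE lerDl lerD2l !mulr_ge0 ?invr_ge0 ?(ltW side0)//=.
    by rewrite ler_pdivrMr// ler_pM2l// ler_nat ltnW.
  by exists t => //; rewrite inE; apply/asboolP.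
have Aq t : t \in s -> (#|A t|%:R : R) <= (2 * n%:R * rho t / side) ^+ m.
  move=> ts; have nr := nrho _ ts.
  pose q := (Num.truncn (n%:R * rho t / side)).+1.
  apply: (@le_trans _ _ (q%:R ^+ m)); last first.
    apply: lerXn2r; rewrite ?nnegrE// ?divr_ge0 ?mulr_ge0 ?(ltW side0) ?(ltW (rho0 _ ts))//.
    have := @truncn_le _ (n%:R * rho t / side).
    rewrite /q -[(Num.truncn _).+1]addn1 natrD (le_trans ler01 nr) => h.
    rewrite -(mulrA 2) -(mulrA 2); lra.
  rewrite -natrX ler_nat -[X in (_ <= _ ^ X)%N]card_ord.
  pose F j := [pred k : 'I_n | [exists f in A t, f j == k]].
  apply: (@leq_trans #|family F|); last first.
    apply: card_family_le => j; apply: card_le_width => k k'.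
    move=> /existsP[f /andP[fA /eqP <-]] /existsP[f' /andP[fA' /eqP <-]].
    have := hU _ ts _ _ (AU _ _ fA') (AU _ _ fA) j; rewrite !mxE.
    rewrite opprD addrACA subrr add0r -!mulrA -mulrBr -mulrBl !normrM.
    rewrite gtr0_norm// normfV (gtr0_norm n0) mulrA ler_pdivrMr// => h.
    have : (f' j)%:R - (f j)%:R <= n%:R * rho t / side.
      rewrite ler_pdivlMr//; apply: le_trans (_ : `|(f' j)%:R - (f j)%:R| * side <= _).
        by rewrite ler_pM2r// ler_norm.
      by rewrite mulrC (le_trans h)// mulrC.
    move=> /le_lt_trans/(_ (truncnS_gt _)); rewrite ltrBlDl -natrD ltr_nat; exact.
  apply: subset_leq_card; apply/fintype.subsetP => f fA; apply/familyP => j.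
  by rewrite inE; apply/existsP; exists f; rewrite fA/=.
have : (n%:R : R) ^+ m <= \sum_(t <- s) (2 * n%:R * rho t / side) ^+ m.
  move: cov; rewrite card_ffun !card_ord -(ler_nat R) natrX => /le_trans; apply.
  by rewrite natr_sum big_seq [leRHS]big_seq; apply: ler_sum => t; exact: Aq.
have -> : \sum_(t <- s) (2 * n%:R * rho t / side) ^+ m =
    (n%:R / side) ^+ m * \sum_(t <- s) (2 * rho t) ^+ m.
  rewrite mulr_sumr; apply: eq_bigr => t _; rewrite -exprMn; congr (_ ^+ _); ring.
rewrite expr_div_n mulrAC -mulrA ler_pMr ?exprn_gt0//.
by rewrite ler_pdivlMr ?mul1r ?exprn_gt0.
Qed.

(** The counterpart of [covering_sum]: a cube of half-side [h t] inscribed in each ball contains at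
    least [(n * h t / r / 2) ^+ d] points of a fine grid on the cube of half-side [r] about [p], and
    disjoint balls share no grid point. *)
Lemma packing_sum d (T : eqType) (s : seq T) (c : T -> 'rV[R]_d)
    (rho : T -> R) (p : 'rV[R]_d) (r : R) :
  0 < r -> uniq s -> (forall t, t \in s -> 0 < rho t) ->
  (forall t, t \in s -> enorm (c t - p) + rho t <= r) ->
  {in s &, forall t t', forall y, enorm (y - c t) <= rho t ->
     enorm (y - c t') <= rho t' -> t = t'} ->
  \sum_(t <- s) rho t ^+ d <= (4 * d.+1%:R * r) ^+ d.
Proof.
move=> r0 us rho0 hr hdisj.
(* The factor [d.+1] puts the cube inside the ball; the factor 2 gives [2 * h t <= rho t], the room
   of one grid step by which the block of indices stays inside the grid. *)
pose h t := rho t / (2 * d.+1%:R).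
have dd0 : 0 < 2 * d.+1%:R :> R by rewrite mulr_gt0.
have h0 t : t \in s -> 0 < h t by move=> ts; rewrite divr_gt0 ?rho0.
have h2 t : t \in s -> h t * 2 <= rho t.
  move=> ts; rewrite /h mulrAC ler_pdivrMr// ler_pM2l ?rho0// ler_peMr//.
  by rewrite ler1n.
have [e e0 eh] := seq_lower_bound h0.
pose n := (Num.truncn (2 * r / e)).+1.
have n0 : 0 < n%:R :> R by rewrite ltr0n.
have nh t : t \in s -> 2 <= n%:R * h t / r.
  move=> ts; rewrite ler_pdivlMr//.
  apply: le_trans (_ : n%:R * e <= _); last by rewrite ler_pM2l ?eh.
  by rewrite -ler_pdivrMr// ltW// truncnS_gt.
pose pt (f : {ffun 'I_d -> 'I_n}) : 'rV[R]_d :=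
  \row_j (p ord0 j - r + 2 * r * (f j)%:R / n%:R).
pose F t j := [pred k : 'I_n | `|p ord0 j - r + 2 * r * k%:R / n%:R - c t ord0 j| <= h t].
pose A t := [set f in family (F t)]%SET.
have Aball t f : t \in s -> f \in A t -> enorm (pt f - c t) <= rho t.
  move=> ts; rewrite inE => /familyP fA.
  apply: le_trans (_ : d%:R * h t <= _).
    apply: enorm_le_coord => [|j]; first exact/ltW/h0.
    by have := fA j; rewrite inE !mxE.
  rewrite /h mulrCA ger_pMr ?rho0// ler_pdivrMr// mul1r -natrM ler_nat.
  by rewrite (leq_trans (leqnSn d))// leq_pmull.
have disj : (\sum_(t <- s) #|A t| <= #|{ffun 'I_d -> 'I_n}|)%N.
  apply: sum_card_disjoint => // t t' ts ts' f fA fA'.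
  exact: (hdisj _ _ ts ts' (pt f) (Aball _ _ ts fA) (Aball _ _ ts' fA')).
have Aq t : t \in s -> (n%:R * h t / r / 2) ^+ d <= (#|A t|%:R : R).
  move=> ts; have nr := nh _ ts.
  pose q := Num.truncn (n%:R * h t / r).
  have /andP[q1 q2] : q%:R <= n%:R * h t / r < q.+1%:R.
    by apply: truncn_itv; rewrite (le_trans _ nr).
  apply: (@le_trans _ _ (q%:R ^+ d)).
    apply: lerXn2r; rewrite ?nnegrE//; first by lra.
    move: q2; rewrite -addn1 natrD; lra.
  rewrite -natrX ler_nat -[X in (_ ^ X <= _)%N]card_ord.
  rewrite /A cardsE; apply: card_family_ge => j.
  have := hr _ ts; have := enorm_coord (c t - p) j; rewrite !mxE => h3 h4.
  have h5 : `|c t ord0 j - p ord0 j| <= r - rho t by lra.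
  move: h5; rewrite ler_norml => /andP[h5 h6].
  have h7 := h2 _ ts; have h8 := h0 _ ts.
  (* The real index at which the grid coordinate equals [c t ord0 j - h t]; the first admissible
     grid index is the next integer. *)
  pose th := (c t ord0 j - p ord0 j + r - h t) * n%:R / (2 * r).
  have th0 : 0 <= th.
    by rewrite divr_ge0 ?mulr_ge0 ?(ltW r0)// ?(ltW n0)//; lra.
  have /andP[t1 t2] := truncn_itv th0.
  have key (x : R) : 2 * r * (x * n%:R / (2 * r)) / n%:R = x.
    by field; rewrite !gt_eqF.
  have hq (k : R) : th <= k <= th + n%:R * h t / r ->
      `|p ord0 j - r + 2 * r * k / n%:R - c t ord0 j| <= h t.
    have -> : k = (k * (2 * r) / n%:R) * n%:R / (2 * r) by field; rewrite !gt_eqF.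
    rewrite /th; move: (k * (2 * r) / n%:R) => y.
    have -> : n%:R * h t / r = (2 * h t) * n%:R / (2 * r) by field; rewrite !gt_eqF.
    rewrite -mulrDl -mulrDl !ler_pM2r ?invr_gt0 ?mulr_gt0// => hy.
    rewrite key ler_norml; lra.
  apply: (@card_ge_interval _ (Num.truncn th).+1).
    rewrite -(ler_nat R) natrD -natr1.
    apply: (@le_trans _ _ (th + n%:R * h t / r + 1)).
      by move: q1 t1; clear; move: (Num.truncn th) => ?; lra.
    have -> : th + n%:R * h t / r + 1 =
        (c t ord0 j - p ord0 j + r + h t + 2 * r / n%:R) * n%:R / (2 * r).
      by rewrite /th; field; rewrite !gt_eqF.
    rewrite ler_pdivrMr ?mulr_gt0// mulrC ler_pM2l//.
    have : 2 * r / n%:R <= h t.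
      by rewrite ler_pdivrMr// mulrC; move: nr; rewrite ler_pdivlMr// mulrC [leRHS]mulrC mulrC.
    lra.
  move=> k /andP[k1 k2]; rewrite inE; apply: hq; apply/andP; split.
    by rewrite (le_trans (ltW t2))// ler_nat.
  have : (k%:R : R) <= (Num.truncn th + q)%:R by rewrite ler_nat -ltnS -addSn.
  by rewrite natrD; move: (Num.truncn th) t1 => ?; lra.
have : \sum_(t <- s) (n%:R * h t / r / 2) ^+ d <= (n%:R : R) ^+ d.
  apply: (@le_trans _ _ (\sum_(t <- s) #|A t|%:R)).
    by rewrite big_seq [leRHS]big_seq; apply: ler_sum => t; exact: Aq.
  by rewrite -natr_sum -natrX ler_nat (leq_trans disj)// card_ffun !card_ord.
have -> : \sum_(t <- s) (n%:R * h t / r / 2) ^+ d =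
    (n%:R / (4 * d.+1%:R * r)) ^+ d * \sum_(t <- s) rho t ^+ d.
  rewrite mulr_sumr; apply: eq_bigr => t _; rewrite -exprMn; congr (_ ^+ _).
  by rewrite /h; field; rewrite !(gt_eqF r0) addrC natr1 pnatr_eq0.
have r40 : 0 < 4 * d.+1%:R * r by rewrite !mulr_gt0.
rewrite expr_div_n mulrAC -mulrA ger_pMr ?exprn_gt0//.
by rewrite ler_pdivrMr ?mul1r ?exprn_gt0.
Qed.

End LatticeCounting.

(** * Similarities and words *)

Section Similarities.
Variables (R : realType) (d : nat).
Implicit Types (x y : 'rV[R]_d) (T : 'rV[R]_d -> 'rV[R]_d).

(* Rescaled and centred, a similarity preserves inner products; in coordinates
   it is then right multiplication by an orthogonal matrix. *)
Lemma similarity_surj (r : R) T : 0 < r -> similarity r T ->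
  forall y, exists x, T x = y.
Proof.
move=> r0 simT.
pose U x := r^-1 *: (T x - T 0).
have U0 : U 0 = 0 by rewrite /U subrr scaler0.
have Uiso x y : enorm (U x - U y) = enorm (x - y).
  rewrite /U -scalerBr opprB addrA subrK enormZ simT gtr0_norm ?invr_gt0//.
  by rewrite mulrA mulVf ?mul1r ?gt_eqF.
pose dot x y := \sum_(i < d) x ord0 i * y ord0 i.
have dotU x y : dot (U x) (U y) = dot x y.
  have polar a b : enorm (a - b) ^+ 2 = enorm a ^+ 2 - 2 * dot a b + enorm b ^+ 2.
    rewrite sqr_enormD enormN; congr (_ + _ + _).
    rewrite /dot -mulrN -sumrN; congr (_ * _); apply: eq_bigr => i _.
    by rewrite mxE mulrN.
  have Un a : enorm (U a) = enorm a by have := Uiso a 0; rewrite U0 !subr0.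
  by have := polar (U x) (U y); rewrite Uiso polar !Un; lra.
pose A := \matrix_(i < d, j < d) U (delta_mx ord0 i) ord0 j.
have dotE x i : dot x (delta_mx ord0 i) = x ord0 i.
  rewrite /dot (bigD1 i)//= mxE !eqxx mulr1 big1 ?addr0// => j ji.
  by rewrite mxE eqxx/= (negbTE ji) mulr0.
have UA x : U x *m A^T = x.
  apply/rowP => i; rewrite mxE -[RHS]dotE -dotU; apply: eq_bigr => j _.
  by rewrite !mxE.
have AA : A *m A^T = 1%:M.
  apply/matrixP => i k; rewrite !mxE.
  transitivity (dot (U (delta_mx ord0 i)) (U (delta_mx ord0 k))).
    by apply: eq_bigr => j _; rewrite !mxE.
  by rewrite dotU dotE mxE eqxx eq_sym.
have Uf x : U x = x *m A by rewrite -{2}(UA x) -mulmxA (mulmx1C AA) mulmx1.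
move=> y; exists ((r^-1 *: (y - T 0)) *m A^T).
have : U ((r^-1 *: (y - T 0)) *m A^T) = r^-1 *: (y - T 0).
  by rewrite Uf -mulmxA (mulmx1C AA) mulmx1.
move=> /(congr1 (fun v => r *: v)); rewrite !scalerA mulfV ?gt_eqF//.
by rewrite !scale1r => /addIr.
Qed.

Lemma similarity_inj (r : R) T x y : 0 < r -> similarity r T -> T x = T y -> x = y.
Proof.
move=> r0 simT Txy; apply/eqP; rewrite -subr_eq0; apply/eqP/enorm_eq0.
have /eqP := simT x y; rewrite Txy subrr enorm0 eq_sym mulf_eq0 gt_eqF//=.
by move/eqP.
Qed.

Lemma similarity_ball (r a : R) T c y : 0 < r -> similarity r T ->
  enorm (y - T c) <= r * a -> exists2 x, T x = y & enorm (x - c) <= a.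
Proof.
move=> r0 simT; have [x <-] := similarity_surj r0 simT y.
by rewrite simT ler_pM2l// => xa; exists x.
Qed.

Lemma affine_similarity (h : R) (p q : 'rV[R]_d) : 0 < h ->
  similarity h (fun z => q + h *: (z - p)).
Proof.
move=> h0 x y; rewrite opprD addrACA subrr add0r -scalerBr enormZ gtr0_norm//.
by rewrite opprB addrA subrK.
Qed.

End Similarities.

(** * Words over the maps and their stopping families *)

Section Words.
Variables (R : realType) (d : nat) (I : eqType) (A : seq I).
Variables (S : I -> 'rV[R]_d -> 'rV[R]_d) (r : I -> R).
Implicit Types (w : seq I) (x y : 'rV[R]_d) (F V : set 'rV[R]_d).

Fixpoint wmap w x := if w is i :: w' then S i (wmap w' x) else x.

Definition weight (g : I -> R) w := \prod_(i <- w) g i.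

(* The words at which the ratio first drops to [e] or below, provided the fuel
   [n] is large enough; for [e = 0] all words of length [n]. *)
Fixpoint stop n (e : R) : seq (seq I) :=
  if n is k.+1 then
    if 1 <= e then [:: [::]] else [seq i :: w | i <- A, w <- stop k (e / r i)]
  else [:: [::]].

Lemma weight_nil g : weight g [::] = 1.
Proof. exact: big_nil. Qed.

Lemma weight_cons g i w : weight g (i :: w) = g i * weight g w.
Proof. exact: big_cons. Qed.

Lemma wmap_cat w w' x : wmap (w ++ w') x = wmap w (wmap w' x).
Proof. by elim: w => //= i w ->. Qed.

Lemma weight_cat g w w' : weight g (w ++ w') = weight g w * weight g w'.
Proof. exact: big_cat. Qed.

Lemma mem_stopS n e w : w \in stop n.+1 e -> w = [::] /\ 1 <= e \/
  exists i w', [/\ w = i :: w', i \in A, w' \in stop n (e / r i) & e < 1].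
Proof.
rewrite /=; case: ifPn => e1; first by rewrite inE => /eqP ->; left.
move=> /allpairsPdep[i [w' [iA w's ->]]]; right; exists i, w'.
by split; rewrite // ltNge.
Qed.

Lemma stop_letters n e w : w \in stop n e -> {subset w <= A}.
Proof.
elim: n e w => [|n ih] e w; first by rewrite inE => /eqP ->.
move=> /mem_stopS[[-> _]//|[i [w' [-> iA /ih w's _]]]] j.
by rewrite inE => /orP[/eqP->//|/w's].
Qed.

Lemma stop_uniq n e : uniq A -> uniq (stop n e).
Proof.
move=> uA; elim: n e => //= n ih e; case: ifP => // _.
apply: allpairs_uniq_dep => // -[i w] [j v] _ _ /= [ij wv].
by rewrite ij wv.
Qed.

Lemma size_stop0 n w : w \in stop n 0 -> size w = n.
Proof.
elim: n w => [|n ih] w; first by rewrite inE => /eqP ->.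
move=> /mem_stopS[[_]|[i [w' [-> _]]]]; first by rewrite ler10.
by rewrite mul0r => /ih /= ->.
Qed.

Lemma sum_stopS n e g : e < 1 -> \sum_(w <- stop n.+1 e) weight g w =
  \sum_(i <- A) g i * \sum_(w <- stop n (e / r i)) weight g w.
Proof.
rewrite ltNge => /negbTE /= ->; rewrite big_allpairs_dep/=.
apply: eq_bigr => i _; rewrite mulr_sumr; apply: eq_bigr => w _.
by rewrite weight_cons.
Qed.

Lemma sum_stop_le1 n e g : (forall i, 0 <= g i) -> \sum_(i <- A) g i <= 1 ->
  \sum_(w <- stop n e) weight g w <= 1.
Proof.
move=> g0 g1; elim: n e => [|n ih] e; first by rewrite big_seq1 weight_nil.
have [e1|e1] := leP 1 e; first by rewrite /= e1 big_seq1 weight_nil.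
rewrite sum_stopS//; apply: le_trans g1; apply: ler_sum => i _.
by rewrite ler_piMr.
Qed.

(** Replacing a word by its one-letter extensions preserves the total weight, so every cross-section
    of the tree of words has total weight 1. *)
Lemma sum_stop_eq1 n e g : \sum_(i <- A) g i = 1 ->
  \sum_(w <- stop n e) weight g w = 1.
Proof.
move=> g1; elim: n e => [|n ih] e; first by rewrite big_seq1 weight_nil.
have [e1|e1] := leP 1 e; first by rewrite /= e1 big_seq1 weight_nil.
rewrite sum_stopS// -[RHS]g1; apply: eq_bigr => i _; by rewrite ih mulr1.
Qed.

Lemma sum_stop0 n g : 
  \sum_(w <- stop n 0) weight g w = (\sum_(i <- A) g i) ^+ n.
Proof.
elim: n => [|n ih]; first by rewrite big_seq1 weight_nil.
rewrite sum_stopS// exprS mulr_suml; apply: eq_bigr => i _.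
by rewrite mul0r ih.
Qed.

Lemma stop_cover n e F :
  (forall x, F x -> exists2 i, i \in A & exists2 y, F y & x = S i y) ->
  forall x, F x -> exists2 w, w \in stop n e & exists2 y, F y & x = wmap w y.
Proof.
move=> cF; elim: n e => [|n ih] e x Fx.
  by exists [::]; [rewrite inE|exists x].
rewrite /=; case: ifP => _; first by exists [::]; [rewrite inE|exists x].
have [i iA [y Fy ->]] := cF _ Fx.
have [w ws [z Fz ->]] := ih (e / r i) _ Fy.
exists (i :: w); last by exists z.
exact: allpairs_f_dep.
Qed.

Hypothesis r0 : forall i, 0 < r i.
Hypothesis simS : forall i, similarity (r i) (S i).

Lemma weight_gt0 w : 0 < weight r w.
Proof. by apply: prodr_gt0 => i _. Qed.

Lemma weight_powR w (s : R) : weight r w `^ s = weight (fun i => r i `^ s) w.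
Proof.
elim: w => [|i w ih]; first by rewrite !weight_nil powR1.
by rewrite !weight_cons powRM ?ltW ?weight_gt0// ih.
Qed.

Lemma wmap_similarity w : similarity (weight r w) (wmap w).
Proof.
elim: w => [|i w ih] x y; first by rewrite weight_nil mul1r.
by rewrite /= simS ih weight_cons mulrA.
Qed.

Lemma stop_ge n e m w : 0 < e -> e <= 1 -> (forall i, i \in A -> m <= r i) ->
  m <= 1 -> 0 < m -> w \in stop n e -> m * e <= weight r w.
Proof.
move=> e0 e1 mr m1 m0 ws.
(* The recursion passes to thresholds [e / r i], which may exceed 1; there the empty word can
   violate the bound, and the first alternative carries it. *)
suff : weight r w = 1 \/ m * e <= weight r w.
  by case=> // ->; nra.
elim: n e w {e1} e0 ws => [|n ih] e w e0.
  by rewrite inE => /eqP ->; left; rewrite weight_nil.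
move=> /mem_stopS[[-> _]|[i [w' [-> iA ws e1]]]]; first by left; rewrite weight_nil.
right; rewrite weight_cons; have mi := mr _ iA.
have [->|h] := ih _ _ (divr_gt0 e0 (r0 i)) ws; first by nra.
have : r i * (m * (e / r i)) <= r i * weight r w' by rewrite ler_pM2l.
by have -> : r i * (m * (e / r i)) = m * e by field; rewrite gt_eqF.
Qed.

Lemma stop_le n e q w : (forall i, i \in A -> r i <= q) ->
  q ^+ n <= e -> w \in stop n e -> weight r w <= e.
Proof.
move=> rq; elim: n e w => [|n ih] e w qe.
  by rewrite inE => /eqP ->; rewrite weight_nil.
move=> /mem_stopS[[-> //]|[i [w' [-> iA ws e1]]]]; first by rewrite weight_nil.
rewrite weight_cons mulrC -ler_pdivlMr//; apply: ih ws.
rewrite ler_pdivlMr//; apply: le_trans qe; rewrite exprSr ler_wpM2l ?rq//.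
by rewrite exprn_ge0// (le_trans _ (rq _ iA))// ltW.
Qed.

Section OpenSet.
Variable (V : set 'rV[R]_d).
Hypothesis SV : forall i x, i \in A -> V x -> V (S i x).
Hypothesis SVdisj : forall i j x y, i \in A -> j \in A -> V x -> V y ->
  S i x = S j y -> i = j.

Lemma wmap_stable w x : {subset w <= A} -> V x -> V (wmap w x).
Proof.
elim: w => //= i w ih iwA Vx; apply: SV; first by apply: iwA; rewrite inE eqxx.
by apply: ih => // j jw; apply: iwA; rewrite inE jw orbT.
Qed.

(** No word of a stopping family is a proper prefix of another, so distinct words part at some
    letter. Cancelling the common prefix by injectivity leaves the disjointness of the first-level
    images. *)
Lemma stop_disjoint n e : {in stop n e &, forall w w', forall x y, V x -> V y ->
  wmap w x = wmap w' y -> w = w'}.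
Proof.
elim: n e => [|n ih] e w w' sw sw' x y Vx Vy.
  by move: sw sw'; rewrite !inE => /eqP-> /eqP->.
move=> E; case/mem_stopS: (sw) E => [[-> e1]|[i [v [-> iA vs e1]]]].
  by case/mem_stopS: sw' => [[-> _]//|[j [v' [_ _ _]]]]; rewrite ltNge e1.
case/mem_stopS: (sw') => [[_]|[j [v' [-> jA v's _]]]] /=; first by rewrite leNgt e1.
move=> E; have ij : i = j.
  by apply: (SVdisj iA jA _ _ E); apply: wmap_stable => //;
    [exact: (stop_letters vs)|exact: (stop_letters v's)].
rewrite -ij in v's E *; congr (_ :: _).
exact: (ih _ _ _ vs v's x y Vx Vy (similarity_inj (r0 i) (simS i) E)).
Qed.

(** Here one word may be a prefix of the other. After cancellation this would put a point of [B]
    into some [S i V], which the gap excludes. *)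
Lemma gap_disjoint (B : set 'rV[R]_d) w w' x y : B `<=` V ->
  (forall i z, i \in A -> V z -> ~ B (S i z)) ->
  {subset w <= A} -> {subset w' <= A} -> B x -> B y ->
  wmap w x = wmap w' y -> w = w'.
Proof.
move=> BV gap; elim: w w' => [|i w ih] [|j w'] //=.
- move=> _ wA Bx By E; exfalso; rewrite E in Bx; apply: gap Bx.
    by apply: wA; rewrite inE eqxx.
  by apply: wmap_stable; [move=> k kw; apply: wA; rewrite inE kw orbT|exact: BV].
- move=> wA _ Bx By E; exfalso; rewrite -E in By; apply: gap By.
    by apply: wA; rewrite inE eqxx.
  by apply: wmap_stable; [move=> k kw; apply: wA; rewrite inE kw orbT|exact: BV].
move=> wA wA' Bx By E.
have hw : {subset w <= A} by move=> k kw; apply: wA; rewrite inE kw orbT.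
have hw' : {subset w' <= A} by move=> k kw; apply: wA'; rewrite inE kw orbT.
have ij : i = j.
  apply: (SVdisj (wA _ (mem_head _ _)) (wA' _ (mem_head _ _)) _ _ E);
    by apply: wmap_stable => //; exact: BV.
rewrite -ij in E *; congr (_ :: _).
exact: (ih _ hw hw' Bx By (similarity_inj (r0 i) (simS i) E)).
Qed.

End OpenSet.

End Words.

(** * Elementary asymptotics and counting *)

Section Preliminaries.
Variable R : realType.

Lemma expr_small (q e : R) : 0 <= q -> q < 1 -> 0 < e -> exists n, q ^+ n <= e.
Proof.
move=> q0 q1 e0; have : (GRing.exp q : nat -> R) @ \oo --> (0 : R).
  by apply: cvg_expr; rewrite ger0_norm.
move=> /cvgrPdist_le/(_ _ e0)[n _ /(_ n (leqnn n))] h; exists n.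
by move: h; rewrite sub0r normrN ger0_norm// exprn_ge0.
Qed.

Lemma le1_bounded_expr (q C : R) : 0 <= q -> (forall n, q ^+ n <= C) -> q <= 1.
Proof.
move=> q0 qC; rewrite leNgt; apply/negP => q1.
have qp : 0 < q by rewrite (lt_trans _ q1).
have C1 : 1 <= C by have := qC 0%N.
have [|||n] := @expr_small q^-1 (C + 1)^-1.
- by rewrite invr_ge0.
- by rewrite invf_lt1.
- by rewrite invr_gt0; lra.
rewrite exprVn lef_pV2 ?posrE ?exprn_gt0//; last lra.
by have := qC n; lra.
Qed.

Lemma size_le_sum_count (T : eqType) (J : finType) (s : seq T) (P : J -> pred T) :
  (forall t, t \in s -> exists j, P j t) -> (size s <= \sum_j count (P j) s)%N.
Proof.
elim: s => [|t s ih] h; first by rewrite big1.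
have [j Pj] := h t (mem_head _ _).
rewrite /= big_split/= -add1n leq_add//; last first.
  by apply: ih => u us; apply: h; rewrite inE us orbT.
by rewrite (bigD1 j)//= Pj.
Qed.

Lemma sumr_ge_size (T : eqType) (s : seq T) (f : T -> R) c :
  (forall t, t \in s -> c <= f t) -> (size s)%:R * c <= \sum_(t <- s) f t.
Proof.
move=> h; rewrite big_seq; apply: le_trans (ler_sum _ h).
by rewrite -big_seq big_const_seq count_predT iter_addr_0 mulr_natl.
Qed.

Lemma sumr_le_size (T : eqType) (s : seq T) (f : T -> R) c :
  (forall t, t \in s -> f t <= c) -> \sum_(t <- s) f t <= (size s)%:R * c.
Proof.
move=> h; rewrite big_seq; apply: le_trans (ler_sum _ h) _.
by rewrite -big_seq big_const_seq count_predT iter_addr_0 mulr_natl.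
Qed.

Lemma cvg_ln_ratio (g : R -> R) (c C D e0 : R) : 0 < c -> 0 < C -> 0 < e0 ->
  (forall e, 0 < e -> e <= e0 -> c * e `^ (- D) <= g e <= C * e `^ (- D)) ->
  ln (g e) / - ln e @[e --> 0^'+] --> D.
Proof.
move=> c0 C0 e00 h; apply/cvgrPdist_le => eps eps0.
pose B := `|ln c| + `|ln C|.
near=> e.
have e_gt0 : 0 < e by near: e; exact: nbhs_right_gt.
have /andP[gl gu] : c * e `^ (- D) <= g e <= C * e `^ (- D).
  by apply: h => //; near: e; apply: nbhs_right_le.
(* The term [B / eps] makes the bounded error [B] at most [eps * - ln e]; the extra 1 keeps [- ln e]
   positive. *)
have ee : e < expR (- (B / eps) - 1).
  by near: e; apply: nbhs_right_lt; exact: expR_gt0.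
have lne : ln e < - (B / eps) - 1.
  by rewrite -[ltRHS]expRK ltr_ln ?posrE ?expR_gt0.
have B0 : 0 <= B / eps by rewrite /B divr_ge0 ?addr_ge0 ?(ltW eps0).
have pw : 0 < e `^ (- D) by rewrite powR_gt0.
have g0 : 0 < g e by rewrite (lt_le_trans _ gl)// mulr_gt0.
have ll : ln c - D * ln e <= ln (g e).
  by rewrite -mulNr -ln_powR -lnM ?posrE// ler_ln ?posrE ?mulr_gt0.
have lu : ln (g e) <= ln C - D * ln e.
  by rewrite -mulNr -ln_powR -lnM ?posrE// ler_ln ?posrE ?mulr_gt0.
have L0 : 0 < - ln e by lra.
have -> : D - ln (g e) / - ln e = (D * - ln e - ln (g e)) / - ln e.
  by field; rewrite lt_eqF// -oppr_gt0.
rewrite normrM normfV (gtr0_norm L0) ler_pdivrMr//.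
apply: (@le_trans _ _ B).
  have := ler_norm (ln C); have := lerNnormlW (lexx `|ln c|).
  rewrite /B ler_norml; have := normr_ge0 (ln c); have := normr_ge0 (ln C).
  by move=> *; apply/andP; split; lra.
by rewrite -ler_pdivrMl// mulrC; lra.
Unshelve. all: by end_near. Qed.

Lemma sum_powR_continuous (T : Type) (s : seq T) (r : T -> R) :
  (forall i, 0 < r i) -> continuous (fun t : R => \sum_(i <- s) r i `^ t).
Proof.
move=> r0 t; apply: cvg_big; first exact: add_continuous.
move=> i _; rewrite /powR gt_eqF//.
apply: continuous_comp; last exact: continuous_expR.
exact: mulrr_continuous.
Qed.

Lemma sum_powR_le1_below (T : Type) (s : seq T) (r : T -> R) (D : R) :
  (forall i, 0 < r i) -> 0 < D -> \sum_(i <- s) r i `^ D < 1 ->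
  exists t, [/\ 0 <= t, t < D & \sum_(i <- s) r i `^ t <= 1].
Proof.
move=> r0 D0 /(cvgr_lt _ (cvg_at_left_filter (@sum_powR_continuous _ s r r0 D))) h.
near (D^'-) => t; exists t; split.
- by near: t; exact: nbhs_left_ge.
- by near: t; exact: nbhs_left_lt.
- by apply: ltW; near: t.
Unshelve. all: by end_near. Qed.

Lemma powR_not_bounded_below (s c C e0 : R) : 0 < s -> 0 < c -> 0 < C -> 0 < e0 ->
  ~ (forall e, 0 < e -> e <= e0 -> c <= C * e `^ s).
Proof.
move=> s0 c0 C0 e00 h.
pose e := Num.min e0 ((c / (2 * C)) `^ (s^-1)).
have cC0 : 0 < c / (2 * C) by rewrite divr_gt0// mulr_gt0.
have ep : 0 < e by rewrite lt_min e00 powR_gt0.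
have := h e ep; rewrite ge_min lexx => /(_ isT).
suff : e `^ s <= c / (2 * C).
  move=> /(ler_wpM2l (ltW C0)).
  have -> : C * (c / (2 * C)) = c / 2 by field; rewrite gt_eqF.
  lra.
have : e <= (c / (2 * C)) `^ (s^-1) by rewrite ge_min lexx orbT.
move=> /(ge0_ler_powR (ltW s0)); rewrite -powRrM mulVf ?gt_eqF// powRr1 ?(ltW cC0)//.
by apply; rewrite nnegrE ?powR_ge0// ltW.
Qed.

End Preliminaries.

(** * Compact sets, diameters and covering numbers *)

Section CompactEuclidean.
Variables (R : realType) (d : nat).
Implicit Types (K F : set 'rV[R]_d).

Lemma enorm_dist_continuous (y : 'rV[R]_d) : continuous (fun x : 'rV[R]_d => enorm (y - x) : R).
Proof.
move=> x U /nbhs_ballP[e/= e0 xeU].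
have e20 : 0 < e / 2 by rewrite divr_gt0.
apply/nbhs_enorm; exists (e / 2) => // z zx; apply: xeU.
rewrite -ball_normE/= ltr_norml.
have := enormB_trans y x z; have := enormB_trans y z x.
by rewrite (enormC x z) => *; apply/andP; split; lra.
Qed.

Lemma compact_nearest K (y : 'rV[R]_d) : K !=set0 -> compact K ->
  exists2 x, K x & forall z, K z -> enorm (y - x) <= enorm (y - z).
Proof.
move=> K0 cK; have [|x] := @compact_EVT_min _ _ (fun x : 'rV[R]_d => enorm (y - x)) K K0 cK.
  exact/continuous_subspaceT/enorm_dist_continuous.
rewrite inE => Kx h; exists x => // z Kz; apply: h; exact: mem_set.
Qed.

Lemma compact_enorm_bounded K (y : 'rV[R]_d) : K !=set0 -> compact K ->
  exists2 b, 0 < b & forall x, K x -> enorm (y - x) <= b.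
Proof.
move=> K0 cK; have [|x] := @compact_EVT_max _ _ (fun x : 'rV[R]_d => enorm (y - x)) K K0 cK.
  exact/continuous_subspaceT/enorm_dist_continuous.
rewrite inE => Kx h; exists (enorm (y - x) + 1); first by rewrite ltr_wpDl ?enorm_ge0.
by move=> z Kz; rewrite (le_trans (h _ (mem_set Kz)))// lerDl.
Qed.

Lemma compact_closure K x : K !=set0 -> compact K ->
  (forall a : R, 0 < a -> exists2 y, K y & enorm (x - y) <= a) -> K x.
Proof.
move=> K0 cK h; have [y Ky yK] := compact_nearest x K0 cK.
suff /enorm_eq0/eqP : enorm (x - y) = 0 by rewrite subr_eq0 => /eqP ->.
apply/eqP; rewrite eq_le enorm_ge0 andbT leNgt; apply/negP => xy0.
have [|z Kz] := h (enorm (x - y) / 2); first by rewrite divr_gt0.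
by have := yK _ Kz; lra.
Qed.

Lemma ediam_le F (b : R) : 0 <= b ->
  (forall x y, F x -> F y -> enorm (x - y) <= b) -> (ediam F <= b%:E)%E.
Proof.
move=> b0 h; apply: ge_ereal_sup => _ [->|[x Fx [y Fy <-]]]; first by rewrite lee_fin.
by rewrite lee_fin; exact: h.
Qed.

Lemma ediam_ge F x y : F x -> F y -> ((enorm (x - y))%:E <= ediam F)%E.
Proof. by move=> Fx Fy; apply: ereal_sup_ubound; right; exists x => //; exists y. Qed.

Lemma ediam_leP F (b : R) x y : (ediam F <= b%:E)%E -> F x -> F y ->
  enorm (x - y) <= b.
Proof. by move=> Fb Fx Fy; rewrite -lee_fin (le_trans (ediam_ge Fx Fy)). Qed.

Lemma covering_number_le F e n (U : 'I_n -> set 'rV[R]_d) :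
  (forall i, ediam (U i) <= e%:E)%E -> F `<=` \bigcup_i U i ->
  covering_number F e <= n%:R.
Proof.
move=> hU FU; apply: ge_inf; first by exists 0 => _ [k _ <-].
by exists n => //; exists U.
Qed.

Lemma covering_number_ge F e n (U : 'I_n -> set 'rV[R]_d) (c : R) :
  (forall i, ediam (U i) <= e%:E)%E -> F `<=` \bigcup_i U i ->
  (forall k (U' : 'I_k -> set 'rV[R]_d), (forall i, ediam (U' i) <= e%:E)%E ->
      F `<=` \bigcup_i U' i -> c <= k%:R) ->
  c <= covering_number F e.
Proof.
move=> hU FU h; apply: lb_le_inf; first by exists n%:R; exists n => //; exists U.
by move=> _ [k [U' [hU' FU']] <-]; apply: h hU' FU'.
Qed.

End CompactEuclidean.

(** * Stopping families at a prescribed scale *)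

Section Stopping.
Variables (R : realType) (d : nat) (I : eqType) (A : seq I) (r : I -> R).
Hypothesis r0 : forall i, 0 < r i.
Hypothesis r1 : forall i, i \in A -> r i < 1.

Definition calibrated (m e : R) n :=
  forall w, w \in stop A r n e -> m * e <= weight r w <= e.

(** At the moment of stopping a word has dropped below [e] by one letter at most, so [m] depends
    only on the smallest ratio and serves all scales. The fuel is found from the largest ratio. *)
Lemma stopping_length : exists2 m : R, 0 < m &
  forall e, 0 < e -> e <= 1 -> exists n, calibrated m e n.
Proof.
have [m m0 mr] : exists2 m, 0 < m & forall i, i \in A -> m <= r i.
  exact: seq_lower_bound.
have [q q0 qr] : exists2 q, 0 < q & forall i, i \in A -> q <= 1 - r i.
  by apply: seq_lower_bound => i /r1; lra.
exists (Num.min m 1); first by rewrite lt_min m0 ltr01.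
move=> e e0 e1; pose q' := Num.max 0 (1 - q).
have [|||n qn] := @expr_small R q' e.
- by rewrite le_max lexx.
- by rewrite gt_max ltr01 gtrBl.
- exact: e0.
exists n => w ws; apply/andP; split.
  apply: stop_ge ws => //; last by rewrite lt_min m0 ltr01.
  by move=> i iA; rewrite ge_min mr.
  by rewrite ge_min lexx orbT.
by apply: stop_le qn ws => // i /qr; rewrite le_max => h; apply/orP; right; lra.
Qed.

(** The terms [weight r w]^ s[add up to at most 1, and each is at least](m * e) [^ s]. *)
Lemma stop_size_le (s m e : R) n : 0 <= s -> 0 < m -> 0 < e -> calibrated m e n ->
  \sum_(i <- A) r i `^ s <= 1 -> (size (stop A r n e))%:R <= (m * e) `^ (- s).
Proof.
move=> s0 m0 e0 hn sum1; rewrite powRN -[leRHS]mul1r ler_pdivlMr ?powR_gt0 ?mulr_gt0//.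
have := @sum_stop_le1 R I A r n e (fun i => r i `^ s) (fun i => powR_ge0 _ _) sum1.
apply: le_trans; apply: sumr_ge_size => w /hn/andP[h _].
rewrite -weight_powR// ge0_ler_powR// ?nnegrE ?mulr_ge0 ?ltW ?weight_gt0//.
Qed.

Lemma stop_size_ge (s m e : R) n : 0 <= s -> 0 < e -> calibrated m e n ->
  \sum_(i <- A) r i `^ s = 1 -> e `^ (- s) <= (size (stop A r n e))%:R.
Proof.
move=> s0 e0 hn sum1; rewrite powRN -[leLHS]mul1r ler_pdivrMr ?powR_gt0//.
rewrite -[leLHS](@sum_stop_eq1 R I A r n e (fun i => r i `^ s) sum1).
apply: sumr_le_size => w /hn/andP[_ h].
by rewrite -weight_powR// ge0_ler_powR// ?nnegrE ?ltW ?weight_gt0.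
Qed.

End Stopping.

(** * Hausdorff measure estimates *)

Section CountableCovers.
Variable R : realType.

Lemma exprD_le (n : nat) (x y : R) : 0 <= x -> 0 <= y ->
  (x + y) ^+ n <= (2 * x) ^+ n + (2 * y) ^+ n.
Proof.
move=> x0 y0; have [xy|/ltW xy] := leP x y.
  apply: (@le_trans _ _ ((2 * y) ^+ n)); last by rewrite lerDr exprn_ge0// mulr_ge0.
  by apply: lerXn2r; rewrite ?nnegrE; lra.
apply: (@le_trans _ _ ((2 * x) ^+ n)); last by rewrite lerDl exprn_ge0// mulr_ge0.
by apply: lerXn2r; rewrite ?nnegrE; lra.
Qed.

Lemma sum_half_expr n : \sum_(0 <= k < n) (2^-1 : R) ^+ k.+1 <= 1.
Proof.
suff -> : \sum_(0 <= k < n) (2^-1 : R) ^+ k.+1 = 1 - 2^-1 ^+ n.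
  by rewrite gerBl exprn_ge0.
elim: n => [|n ih]; first by rewrite big_geq// expr0 subrr.
by rewrite big_nat_recr//= ih exprS; lra.
Qed.

(** Each set is thickened by [eta k] to a neighbourhood, compactness of the cube gives a finite
    subcover, and [covering_sum] applies to it. The thickening accounts for at most half of
    [side ^+ m]. *)
Lemma countable_covering_sum m (U : nat -> set 'rV[R]_m) (rho : nat -> R)
    (a : 'rV[R]_m) (side : R) :
  0 < side -> (forall k, 0 <= rho k) ->
  (forall k x y, U k x -> U k y -> forall j, `|x ord0 j - y ord0 j| <= rho k) ->
  (forall x : 'rV[R]_m, (forall j, a ord0 j <= x ord0 j <= a ord0 j + side) ->
     exists k, U k x) ->
  (((side / 4) ^+ m / 2)%:E <=
     \sum_(0 <= k <oo) if `[< U k !=set0 >] then (rho k ^+ m)%:E else 0)%E.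
Proof.
move=> side0 rho0 hU cov.
pose g k := (if `[< U k !=set0 >] then (rho k ^+ m)%:E else 0)%E.
have g0 k : (0 <= g k)%E by rewrite /g; case: ifP => // _; rewrite lee_fin exprn_ge0.
have gsum n : \sum_(0 <= k < n) g k =
    (\sum_(0 <= k < n | `[< U k !=set0 >]) rho k ^+ m)%:E.
  by rewrite [in RHS]big_mkcond/= -sumEFin; apply: eq_bigr => k _; rewrite /g; case: ifP.
suff [n hn] : exists n, (side / 4) ^+ m / 2 <=
    \sum_(0 <= k < n | `[< U k !=set0 >]) rho k ^+ m.
  by apply: le_trans (@nneseries_lim_ge R g xpredT 0 n _) => //; rewrite gsum lee_fin.
(* For [m = 0] a thickening never costs little, since every power is 1; but then one nonempty [U k]
   suffices. *)
have [m0|m0] := posnP m.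
  have [j|k Uk] := cov a; first by have := ltn_ord j; rewrite {2}m0.
  exists k.+1; rewrite big_mkcond/= big_nat_recr//= asboolT; last by exists a.
  have e1 (y : R) : y ^+ m = 1 by rewrite m0 expr0.
  rewrite !e1 (le_trans (_ : _ <= 1))//; first lra.
  by rewrite lerDr sumr_ge0// => i _; case: ifP => // _; rewrite exprn_ge0.
(* With 16 the thickening enters [exprD_le] as [8 * eta k], which is [side / 2] times
   [2^-1 ^+ k.+1]; its powers sum to at most [side ^+ m / 2]. *)
pose eta k : R := side / 16 * 2^-1 ^+ k.+1.
have eta0 k : 0 < eta k by rewrite mulr_gt0 ?divr_gt0 ?exprn_gt0.
pose N k := [set y | exists2 x, U k x & enorm (y - x) <= eta k].
have UN k x : U k x -> (N k)° x.
  by move=> Uk; apply/nbhs_enorm; exists (eta k) => // y yx; exists x.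
have NU k x y : N k x -> N k y -> forall j,
    `|x ord0 j - y ord0 j| <= rho k + 2 * eta k.
  move=> [x' Ux' xx'] [y' Uy' yy'] j; have h := hU _ _ _ Ux' Uy' j.
  have := enorm_coord (x - x') j; have := enorm_coord (y - y') j; rewrite !mxE => h1 h2.
  have := ler_distD (x' ord0 j) (x ord0 j) (y ord0 j).
  have := ler_distD (y' ord0 j) (x' ord0 j) (y ord0 j).
  rewrite (distrC (y' ord0 j) (y ord0 j)); lra.
have : compact [set x : 'rV[R]_m | forall j, `[a ord0 j, a ord0 j + side]%classic (x ord0 j)].
  apply: (@rV_compact R m (fun j => `[a ord0 j, a ord0 j + side]%classic)) => j.
  exact: segment_compact.
rewrite compact_cover => /(_ nat setT (fun k => (N k)°)) [].
- by move=> k _; exact: open_interior.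
- move=> x hx; have [|k Uk] := cov x; last by exists k => //; exact: UN.
  by move=> j; have := hx j; rewrite /= in_itv.
move=> D' _ hD'; pose n := (\max_(k <- finmap.enum_fset D') k).+1; exists n.
pose s := [seq k <- index_iota 0 n | `[< U k !=set0 >]].
have : side ^+ m <= \sum_(k <- s) (2 * (rho k + 2 * eta k)) ^+ m.
  apply: (covering_sum (U := N) (a := a)) => //.
  - by move=> k _; rewrite ltr_wpDl// mulr_gt0.
  - by move=> k _; exact: NU.
  move=> x hx; have [|k /= kD /interior_subset Nk] := hD' x.
    by move=> j; rewrite /= in_itv; exact: hx.
  exists k => //; rewrite mem_filter mem_index_iota/= ltnS; apply/andP; split.
    by apply/asboolP; case: Nk => z Uz _; exists z.
  exact: leq_bigmax_seq.
rewrite big_filter => h.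
have {}h : side ^+ m <= \sum_(0 <= k < n | `[< U k !=set0 >])
    (4 ^+ m * rho k ^+ m + side ^+ m * 2^-1 * 2^-1 ^+ k.+1).
  apply: (le_trans h); apply: ler_sum => k _; rewrite mulrDr.
  have e40 : 0 <= 2 * (2 * eta k) by rewrite !mulr_ge0// ltW.
  apply: le_trans (exprD_le _ _ e40) _; first by rewrite mulr_ge0.
  rewrite lerD//; first by rewrite -exprMn mulrA -natrM.
  have -> : 2 * (2 * (2 * eta k)) = side * (2^-1 * 2^-1 ^+ k.+1) by rewrite /eta; field.
  rewrite exprMn -mulrA ler_wpM2l ?exprn_ge0 ?(ltW side0)//.
  rewrite -(prednK m0) exprS ler_piMr ?mulr_ge0 ?exprn_ge0//.
  by rewrite exprn_ile1 ?mulr_ge0 ?exprn_ge0// mulr_ile1 ?exprn_ge0// ?exprn_ile1//; lra.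
have : \sum_(0 <= k < n | `[< U k !=set0 >]) side ^+ m * 2^-1 * 2^-1 ^+ k.+1 <= side ^+ m / 2.
  apply: (@le_trans _ _ (\sum_(0 <= k < n) side ^+ m * 2^-1 * 2^-1 ^+ k.+1)).
    rewrite [leLHS]big_mkcond/=; apply: ler_sum => k _; case: ifP => // _.
    by rewrite !mulr_ge0 ?exprn_ge0// ltW.
  by rewrite -mulr_sumr ler_piMr ?sum_half_expr// mulr_ge0 ?exprn_ge0// ltW.
move: h; rewrite big_split/= -mulr_sumr => h1 h2.
rewrite expr_div_n mulrAC ler_pdivrMr ?exprn_gt0// [leRHS]mulrC.
by move: h1 h2; move: (\sum_(_ <= _ < _ | _) _ * _) (4 ^+ m * _) => x y; lra.
Qed.

Lemma unit_ball_volume_gt0 k : 0 < unit_ball_volume R k.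
Proof.
suff : 0 < unit_ball_volume R k /\ 0 < unit_ball_volume R k.+1 by case.
elim: k => [|k [ih1 ih2]]; first by split; rewrite /= ?ltr01.
by split => //=; rewrite mulr_gt0// divr_gt0// mulr_gt0// pi_gt0.
Qed.

End CountableCovers.

(** * Boundary crossings along segments *)

Section Crossing.
Variables (R : realType) (d : nat).
Implicit Types (P : set 'rV[R]_d) (x z p u : 'rV[R]_d).

(** The crossing lies at the supremum of the parameters landing in [P]: points of [P] accumulate
    there, and an interior point would let the supremum be exceeded. *)
Lemma segment_crosses_boundary P p u : P p -> ~ P (p + u) ->
  exists t, [/\ 0 <= t, t <= 1 & boundary P (p + t *: u)].
Proof.
move=> Pp Ppu; pose T := [set t | [/\ 0 <= t, t <= 1 & P (p + t *: u)]].
have T0 : T 0 by split => //; rewrite scale0r addr0.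
have hT : has_sup T by split; [exists 0|exists 1 => t []].
pose s := sup T.
have s0 : 0 <= s by apply: ub_le_sup => //; case: hT.
have s1 : s <= 1 by apply: ge_sup; [exists 0|move=> t []].
have dist t t' : enorm (p + t *: u - (p + t' *: u)) = `|t - t'| * enorm u.
  by rewrite opprD addrACA subrr add0r -scalerBl enormZ.
have u1 : 0 < enorm u + 1 by rewrite ltr_wpDl ?enorm_ge0.
exists s; split => //; split.
  apply/closure_enorm => a a0.
  have [|t Tt st] := sup_adherent (_ : 0 < a / (enorm u + 1)) hT.
    by rewrite divr_gt0.
  have ts : t <= s by apply: ub_le_sup => //; case: hT.
  exists (p + t *: u); first by case: Tt.
  rewrite dist distrC ger0_norm ?subr_ge0//.
  apply: (@le_trans _ _ (a / (enorm u + 1) * (enorm u + 1))); last by rewrite divfK// gt_eqF.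
  by rewrite ler_pM ?subr_ge0 ?enorm_ge0// ?lerDl//; rewrite /s; lra.
move=> Is; have sP := interior_subset Is.
have s_lt1 : s < 1.
  rewrite lt_neqAle s1 andbT; apply/eqP => s1'; apply: Ppu.
  by rewrite -[u]scale1r -s1'.
move/nbhs_enorm: Is => [a a0 aP].
pose t := Num.min 1 (s + a / (enorm u + 1)).
have st : s < t by rewrite lt_min s_lt1 ltrDl divr_gt0.
have : T t.
  split; [by rewrite (le_trans s0)// ltW|by rewrite ge_min lexx|].
  apply: aP; rewrite dist ger0_norm ?subr_ge0 ?(ltW st)//.
  apply: (@le_trans _ _ (a / (enorm u + 1) * (enorm u + 1))); last by rewrite divfK// gt_eqF.
  rewrite ler_pM ?subr_ge0 ?(ltW st) ?enorm_ge0// ?lerDl//.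
  by rewrite lerBlDl ge_min lexx orbT.
by move=> /(ub_le_sup (proj2 hT)); rewrite leNgt st.
Qed.

Lemma gauge_ge0 m (A : set 'rV[R]_d) : (0 <= hausdorff_gauge m A)%E.
Proof.
rewrite /hausdorff_gauge; case: ifP => // _; apply: expe_ge0.
by apply: ereal_sup_ubound; left.
Qed.

Lemma gauge_fin m (A : set 'rV[R]_d) (b : R) : (ediam A <= b%:E)%E ->
  exists rho : R, [/\ 0 <= rho, ediam A = rho%:E &
    A !=set0 -> hausdorff_gauge m A = (rho ^+ m)%:E].
Proof.
move=> Ab; have A0 : (0 <= ediam A)%E by apply: ereal_sup_ubound; left.
have Afin : ediam A \is a fin_num.
  by rewrite ge0_fin_numE// (le_lt_trans Ab)// ltry.
exists (fine (ediam A)); split; rewrite ?fine_ge0 ?fineK//.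
move=> /set0P A1; rewrite /hausdorff_gauge (negbTE A1).
by rewrite -{1}(fineK Afin) EFin_expe.
Qed.

End Crossing.

(* Projecting along [z - x], in the coordinate directions other than the
   dominant one of [z - x], maps the boundary points found on the segments
   parallel to [x, z] onto a cube. *)
Lemma crossing_gauge (R : realType) (d : nat) (P : set 'rV[R]_d) (x z : 'rV[R]_d)
    (h b : R) (U : nat -> set 'rV[R]_d) : (0 < d)%N -> 0 < h ->
  (forall y, enorm (y - x) <= d%:R * h -> P y) ->
  (forall y, enorm (y - z) <= d%:R * h -> ~ P y) ->
  (forall k, ediam (U k) <= b%:E)%E -> boundary P `<=` \bigcup_k U k ->
  (((h / 4) ^+ d.-1 / 2)%:E <= \sum_(0 <= k <oo)
     if `[< exists2 y, U k y & (enorm (y - x) <= enorm (z - x) + d%:R * h)%R >]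
     then hausdorff_gauge d.-1 (U k) else 0)%E.
Proof.
case: d => // m in P x z U *; move=> _ h0 Px Pz hU cov.
pose u := z - x.
have dh0 : 0 <= m.+1%:R * h by rewrite mulr_ge0// ltW.
have u0 : u != 0.
  apply/eqP => u0; apply: (Pz x); last by apply: Px; rewrite subrr enorm0.
  by rewrite -enormN opprB -/u u0 enorm0.
case: (@arg_maxP _ _ _ ord0 xpredT (fun i => `|u ord0 i|) isT) => i _ imax.
have ui0 : 0 < `|u ord0 i|.
  rewrite normr_gt0; apply: contraNneq u0 => ui; apply/eqP/rowP => j.
  by rewrite [RHS]mxE; apply/eqP; rewrite -normr_le0 (le_trans (imax j isT))//= ui normr0.
pose iota (q : 'rV[R]_m) : 'rV[R]_m.+1 :=
  \row_j (if unlift i j is Some j' then q ord0 j' else 0).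
have iota_i q : iota q ord0 i = 0 by rewrite mxE unlift_none.
have iota_lift (q : 'rV[R]_m) (j : 'I_m) : iota q ord0 (lift i j) = q ord0 j by rewrite mxE liftK.
pose y q t := x + iota q + t *: u.
pose U' k := [set q : 'rV[R]_m | (forall j, `|q ord0 j| <= h) /\
  exists t, [/\ 0 <= t, t <= 1 & U k (y q t)]].
have norm_iota (q : 'rV[R]_m) : (forall j, `|q ord0 j| <= h) -> enorm (iota q) <= m.+1%:R * h.
  move=> qh; apply: enorm_le_coord => [|j]; first exact: ltW.
  by rewrite mxE; case: unliftP => [j'|] _; rewrite ?normr0 ?(ltW h0).
(* Eliminating [t] through coordinate [i] recovers [q] from the crossing point. As [i] is dominant,
   the slopes have modulus at most 1, whence the bound [2 * rho k] on each coordinate of the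
   projected set. *)
have y_coord (q : 'rV[R]_m) t (j : 'I_m) : y q t ord0 (lift i j) =
    q ord0 j + u ord0 (lift i j) / u ord0 i * (y q t ord0 i - x ord0 i) + x ord0 (lift i j).
  have ui : u ord0 i != 0 by rewrite -normr_gt0.
  rewrite /y; move: (u) ui => v' vi.
  by rewrite !mxE unlift_none liftK addr0; field.
have y_near (q : 'rV[R]_m) t : (forall j, `|q ord0 j| <= h) -> 0 <= t -> t <= 1 ->
    enorm (y q t - x) <= enorm (z - x) + m.+1%:R * h.
  move=> qh t0 t1; rewrite /y -(addrA x) (addrC x) addrK addrC (le_trans (enormD _ _))//.
  by rewrite lerD ?norm_iota// enormZ ger0_norm// ler_piMl ?enorm_ge0.
have U'U k : U' k !=set0 -> exists2 y, U k y & enorm (y - x) <= enorm (z - x) + m.+1%:R * h.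
  by move=> [q [qh [t [t0 t1 Uk]]]]; exists (y q t) => //; exact: y_near.
pose rho k := fine (ediam (U k)).
have hrho k : [/\ 0 <= rho k, ediam (U k) = (rho k)%:E &
    U k !=set0 -> hausdorff_gauge m (U k) = ((rho k) ^+ m)%:E].
  by have [s [s0 sE hs]] := gauge_fin m (hU k); rewrite /rho sE.
have U'diam k q q' : U' k q -> U' k q' ->
    forall j, `|q ord0 j - q' ord0 j| <= 2 * rho k.
  move=> [_ [t [_ _ Ut]]] [_ [t' [_ _ Ut']]] j.
  have [_ dE _] := hrho k.
  have dd : enorm (y q t - y q' t') <= rho k by apply: ediam_leP Ut Ut'; rewrite dE.
  have -> : q ord0 j - q' ord0 j = (y q t - y q' t') ord0 (lift i j) -
      u ord0 (lift i j) / u ord0 i * (y q t - y q' t') ord0 i.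
    have e1 := y_coord q t j; have e2 := y_coord q' t' j.
    rewrite [(y q t - y q' t') ord0 (lift i j)]mxE [(- y q' t') ord0 (lift i j)]mxE e1 e2.
    rewrite [(y q t - y q' t') ord0 i]mxE [(- y q' t') ord0 i]mxE; ring.
  rewrite (le_trans (ler_normB _ _))// mulrDl mul1r lerD//.
    exact: le_trans (enorm_coord _ _) dd.
  rewrite normrM normrM normfV -[leRHS]mul1r ler_pM ?mulr_ge0 ?invr_ge0//.
    by rewrite ler_pdivrMr// mul1r; exact: imax.
  exact: le_trans (enorm_coord _ _) dd.
have U'cov (q : 'rV[R]_m) : (forall j, (const_mx (- h) : 'rV[R]_m) ord0 j <= q ord0 j <=
     (const_mx (- h) : 'rV[R]_m) ord0 j + 2 * h) -> exists k, U' k q.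
  move=> qh; have {}qh j : `|q ord0 j| <= h.
    by rewrite ler_norml; have := qh j; rewrite mxE => /andP[*]; apply/andP; split; lra.
  have [||t [t0 t1 bt]] := @segment_crosses_boundary _ _ P (x + iota q) u.
  - by apply: Px; rewrite (addrC x) addrK norm_iota.
  - by apply: Pz; rewrite /u (addrC z) addrA addrK (addrC x) addrK norm_iota.
  by have [k _ Uk] := cov _ bt; exists k; split => //; exists t.
have h20 : 0 < 2 * h by rewrite mulr_gt0.
have r20 k : 0 <= 2 * rho k by rewrite mulr_ge0//; case: (hrho k).
have := countable_covering_sum h20 r20 U'diam U'cov.
have -> : ((2 * h / 4) ^+ m / 2) = 2 ^+ m * ((h / 4) ^+ m / 2).
  by rewrite mulrA -exprMn mulrA.
move=> main.
rewrite -(@lee_pmul2l _ (2 ^+ m)%:E) ?lte_fin ?exprn_gt0// -EFinM.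
apply: (le_trans main); rewrite -nneseriesZl; last first.
  by move=> k _; case: ifP => // _; exact: gauge_ge0.
apply: lee_nneseries => [k _ _|k _].
  by case: ifP => // _; rewrite lee_fin exprn_ge0.
case: ifP => [/asboolP U'k|_]; last first.
  by apply: mule_ge0; [rewrite lee_fin exprn_ge0|case: ifP => // _; exact: gauge_ge0].
have [v Uv vx] := U'U _ U'k; rewrite asboolT; last by exists v.
have [_ _ ->] := hrho k; last by exists v.
by rewrite -EFinM exprMn.
Qed.

(** * Lipschitz pieces of the boundary of a parallel set *)

Section LipschitzPieces.
Variables (R : realType).

Lemma truncn_eq_dist (h x y : R) : 0 < h -> 0 <= x -> 0 <= y ->
  Num.truncn (x / h) = Num.truncn (y / h) -> `|x - y| <= h.
Proof.
move=> h0 x0 y0.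
have /truncn_itv : 0 <= x / h by rewrite divr_ge0// ltW.
have /truncn_itv : 0 <= y / h by rewrite divr_ge0// ltW.
move=> /andP[y1 y2] /andP[x1 x2] E; rewrite E in x1 x2.
move: y1 y2 x1 x2; rewrite -natr1 !ler_pdivlMr// !ltr_pdivrMr// mulrDl mul1r.
by rewrite ler_norml => *; apply/andP; split; lra.
Qed.

Variable d : nat.
Implicit Types (x y p : 'rV[R]_d) (K E : set 'rV[R]_d).

Lemma enorm_pigeonhole x : (0 < d)%N -> exists i, enorm x / d%:R <= `|x ord0 i|.
Proof.
case: d x => // m x _.
case: (@arg_maxP _ _ _ ord0 xpredT (fun i => `|x ord0 i|) isT) => i _ imax.
exists i; rewrite ler_pdivrMr// mulrC; apply: enorm_le_coord => // j.
exact: imax.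
Qed.

(* Moving from [y] against the direction [y - x] enters the ball of radius [e]
   around [x], so the points at distance at least [e] from [x] near [y] stay in
   the complement of a cone. *)
Lemma graph_one_side (e h : R) x y y' i : 0 < e -> 0 <= h -> h <= e ->
  enorm (y - x) = e -> e <= enorm (y' - x) ->
  e / d%:R <= `|(y - x) ord0 i| -> (y - x) ord0 i * (y' - y) ord0 i <= 0 ->
  (forall j, j != i -> `|(y' - y) ord0 j| <= h) ->
  `|(y' - y) ord0 i| <= e / d%:R ->
  `|(y' - y) ord0 i| <= 3 * d%:R ^+ 2 * h.
Proof.
move=> e0 h0 he yx y'x ui uv vj vi.
have d0 : 0 < d%:R :> R by rewrite ltr0n; case: d i {ui uv vj vi} => // -[].
(* With [u = y - x] and [v = y' - y] this says that the square of [v] plus twice its product with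
   [u] is nonnegative. The bound on [v ord0 i] lets half of the negative linear term absorb the
   square in coordinate [i]; the other coordinates give the constant 3. *)
have : e ^+ 2 <= enorm (y' - x) ^+ 2.
  by apply: lerXn2r; rewrite ?nnegrE ?enorm_ge0// ltW.
have -> : y' - x = (y' - y) + (y - x) by rewrite addrA subrK.
rewrite sqr_enormD yx sqr_enorm.
move: (y - x) (y' - y) yx ui uv vj vi => u v ue ui uv vj vi {y x y' y'x}.
have dot_le : \sum_(k < d) v ord0 k * u ord0 k <= - (`|v ord0 i| * (e / d%:R)) + d%:R * (h * e).
  rewrite (bigD1 i)//= lerD//.
    have -> : v ord0 i * u ord0 i = - (`|v ord0 i| * `|u ord0 i|).
      by rewrite -normrM ler0_norm ?opprK// mulrC.
    by rewrite lerN2 ler_wpM2l.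
  apply: (@le_trans _ _ (\sum_(k < d) h * e)); last by rewrite sumr_const card_ord mulr_natl.
  rewrite [leRHS](bigD1 i)//= ler_wpDl ?mulr_ge0 ?(ltW e0)//.
  apply: ler_sum => j ji; rewrite (le_trans (ler_norm _))// normrM ler_pM// ?vj//.
  by rewrite -ue enorm_coord.
have sq_le : \sum_(k < d) v ord0 k ^+ 2 <= `|v ord0 i| * (e / d%:R) + d%:R * (h * e).
  rewrite (bigD1 i)//= lerD//.
    by rewrite -real_normK ?num_real// expr2 ler_wpM2l.
  apply: (@le_trans _ _ (\sum_(k < d) h * e)); last by rewrite sumr_const card_ord mulr_natl.
  rewrite [leRHS](bigD1 i)//= ler_wpDl ?mulr_ge0 ?(ltW e0)//.
  apply: ler_sum => j ji; rewrite -real_normK ?num_real// expr2 ler_pM ?vj//.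
  by rewrite (le_trans (vj _ ji)).
move=> main; have : `|v ord0 i| * (e / d%:R) <= 3 * (d%:R * (h * e)) by lra.
have -> : 3 * (d%:R * (h * e)) = 3 * d%:R ^+ 2 * h * (e / d%:R) by field; rewrite gt_eqF.
by rewrite ler_pM2r// divr_gt0.
Qed.

(** If the displacement runs along the normal at [y] instead of against it, exchanging [y] and [y']
    reverses it, and the equal signs of the two normals bring back [graph_one_side]. *)
Lemma graph_sides (e h : R) x y x' y' i : 0 < e -> 0 <= h -> h <= e ->
  enorm (y - x) = e -> enorm (y' - x') = e ->
  e <= enorm (y' - x) -> e <= enorm (y - x') ->
  e / d%:R <= `|(y - x) ord0 i| -> e / d%:R <= `|(y' - x') ord0 i| ->
  (0 <= (y - x) ord0 i) = (0 <= (y' - x') ord0 i) ->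
  (forall j, j != i -> `|(y' - y) ord0 j| <= h) ->
  `|(y' - y) ord0 i| <= e / d%:R ->
  `|(y' - y) ord0 i| <= 3 * d%:R ^+ 2 * h.
Proof.
move=> e0 h0 he yx y'x' y'x yx' ui ui' sg vj vi.
have [uv|uv] := leP ((y - x) ord0 i * (y' - y) ord0 i) 0.
  exact: graph_one_side y'x ui uv vj vi.
have sym j : `|(y - y') ord0 j| = `|(y' - y) ord0 j|.
  by rewrite !mxE distrC.
rewrite -sym; apply: (@graph_one_side e h x' y' y i) => //; last by rewrite sym.
  have -> : (y - y') ord0 i = - (y' - y) ord0 i by rewrite !mxE opprB.
  have [s|s] := leP 0 ((y - x) ord0 i); move: sg.
    rewrite s => /esym s'; rewrite mulrN oppr_le0 mulr_ge0//.
    rewrite leNgt; apply/negP => v0; move: uv.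
    by rewrite ltNge mulr_ge0_le0// ltW.
  rewrite leNgt s => /esym/negbT; rewrite -ltNge => s'.
  rewrite mulrN oppr_le0; move: uv; rewrite nmulr_rgt0// => /ltW v0.
  by rewrite nmulr_rge0.
by move=> j ji; rewrite sym vj.
Qed.

End LipschitzPieces.

(* The pieces are indexed by the dominant coordinate of the normal direction,
   its sign, a coarse cell in that coordinate and a fine cell in the others;
   each is part of a Lipschitz graph. *)
Lemma local_cover (R : realType) (d : nat) (B : R) : (0 < d)%N -> 0 < B ->
  exists2 C : R, 0 <= C & forall e delta : R, 0 < e -> 0 < delta ->
  exists (rho : R) (J : finType), [/\ 0 <= rho, rho <= delta,
    #|J|%:R * rho ^+ d.-1 <= C * e ^+ d.-1 &
    forall (K : set 'rV[R]_d) (p : 'rV[R]_d) (E : set 'rV[R]_d),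
      (forall y, E y -> enorm (y - p) <= B * e /\ exists2 x, K x & enorm (y - x) = e) ->
      (forall y x, E y -> K x -> e <= enorm (y - x)) ->
      exists U : J -> set 'rV[R]_d,
        (forall j y y', U j y -> U j y' -> enorm (y - y') <= rho) /\
        (forall y, E y -> exists j, U j y)].
Proof.
case: d => // m _ B0; set d := m.+1.
have d0 : 0 < d%:R :> R by rewrite ltr0n.
have d1 : 1 <= d%:R :> R by rewrite ler1n.
pose M := (Num.truncn (2 * B * d%:R)).+1.
pose c3 : R := 3 * d%:R ^+ 3; have c30 : 0 < c3 by rewrite mulr_gt0// exprn_gt0.
exists ((d * 2 * M)%:R * (4 * B * c3) ^+ m).
  by rewrite mulr_ge0// exprn_ge0// ltW// !mulr_gt0.
move=> e delta e0 delta0.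
(* The summand [2 * B] makes the fine cell size [h] at most [e], the other one makes [c3 * h] at
   most [delta]. *)
pose n := (Num.truncn (2 * B + 2 * B * e * c3 / delta)).+1.
have n0 : 0 < n%:R :> R by rewrite ltr0n.
have nlarge : 2 * B + 2 * B * e * c3 / delta <= n%:R by rewrite ltW// truncnS_gt.
have nge1 : 0 <= 2 * B * e * c3 / delta by rewrite divr_ge0 ?mulr_ge0 ?ltW.
pose h := 2 * B * e / n%:R; have h0 : 0 < h by rewrite divr_gt0 ?mulr_gt0.
have he : h <= e.
  by rewrite /h ler_pdivrMr// mulrC ler_pM2l//; lra.
(* The index set ['I_n.+1] admits the right end of the range; [n.+1 <= 2 * n] then costs the factor
   that turns [2 * B] into [4 * B]. *)
pose J := ('I_d * bool * 'I_M * {ffun 'I_m -> 'I_n.+1})%type.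
exists (c3 * h), J; split.
- by rewrite mulr_ge0// ltW.
- have -> : c3 * h = (2 * B * e * c3 / delta) * (delta / n%:R).
    by rewrite /h; field; rewrite !gt_eqF.
  rewrite mulrCA ler_piMr ?(ltW delta0)// ler_pdivrMr// mul1r; lra.
- rewrite !card_prod card_ffun !card_ord card_bool natrM -[leLHS]mulrA -[leRHS]mulrA.
  rewrite ler_wpM2l// natrX -!exprMn; apply: lerXn2r;
    rewrite ?nnegrE ?mulr_ge0 ?(ltW e0) ?(ltW B0) ?(ltW c30) ?(ltW h0)//.
  have -> : n.+1%:R * (c3 * h) = (n.+1%:R / n%:R) * (2 * B * c3 * e).
    by rewrite /h; field; rewrite gt_eqF.
  have -> : 4 * B * c3 * e = 2 * (2 * B * c3 * e) by ring.
  rewrite ler_pM2r ?mulr_gt0// ler_pdivrMr// -natrM ler_nat mul2n -addnn.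
  by rewrite -addn1 leq_add2l.
move=> K p E hE hK.
have ed0 : 0 < e / d%:R by rewrite divr_gt0.
have co0 y k : E y -> 0 <= y ord0 k - p ord0 k + B * e.
  move=> /hE[yp _]; have := enorm_coord (y - p) k; rewrite !mxE => t1.
  by have := le_trans t1 yp; rewrite ler_norml => /andP[*]; lra.
have co1 y k : E y -> y ord0 k - p ord0 k + B * e <= 2 * B * e.
  move=> /hE[yp _]; have := enorm_coord (y - p) k; rewrite !mxE => t1.
  by have := le_trans t1 yp; rewrite ler_norml => /andP[*]; lra.
pose co (y : 'rV[R]_d) k : R := y ord0 k - p ord0 k + B * e.
pose U (j : J) := let: (i, sg, c, f) := j in [set y | E y /\
  [/\ exists x, [/\ K x, enorm (y - x) = e, e / d%:R <= `|(y - x) ord0 i| &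
     (0 <= (y - x) ord0 i) = sg],
     Num.truncn (co y i / (e / d%:R)) = c :> nat &
     forall k, Num.truncn (co y (lift i k) / h) = f k :> nat]].
exists U; split.
  move=> [[[i sg] c] f] y y' [Ey [[x [Kx yx ui sgx]] yc yf]]
    [Ey' [[x' [Kx' yx' ui' sgx']] y'c y'f]].
  have codiff k : y' ord0 k - y ord0 k = co y' k - co y k by rewrite /co; ring.
  have vj j : j != i -> `|(y' - y) ord0 j| <= h.
    rewrite eq_sym => /unlift_some[k -> _]; rewrite !mxE codiff.
    by apply: truncn_eq_dist => //; rewrite ?co0// yf y'f.
  have vi : `|(y' - y) ord0 i| <= e / d%:R.
    by rewrite !mxE codiff; apply: truncn_eq_dist => //; rewrite ?co0// yc y'c.
  have vi' : `|(y' - y) ord0 i| <= 3 * d%:R ^+ 2 * h.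
    have sgE : (0 <= (y - x) ord0 i) = (0 <= (y' - x') ord0 i) by rewrite sgx sgx'.
    exact: (graph_sides e0 (ltW h0) he yx yx' (hK _ _ Ey' Kx) (hK _ _ Ey Kx')
      ui ui' sgE vj vi).
  have -> : c3 * h = d%:R * (3 * d%:R ^+ 2 * h) by rewrite /c3; ring.
  rewrite enormC; apply: enorm_le_coord => [|j].
    by rewrite !mulr_ge0 ?exprn_ge0// ltW.
  have [->//|ji] := eqVneq j i; apply: le_trans (vj _ ji) _.
  rewrite ler_peMl ?(ltW h0)//; have : 1 <= d%:R ^+ 2 :> R by rewrite exprn_ege1.
  lra.
move=> y Ey; have [_ [x Kx yx]] := hE _ Ey.
have [i ui] := enorm_pigeonhole (y - x) (ltn0Sn m).
have cM : (Num.truncn (co y i / (e / d%:R)) < M)%N.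
  rewrite -(ltr_nat R); apply: le_lt_trans (_ : 2 * B * d%:R < _); last exact: truncnS_gt.
  apply: (@le_trans _ _ (co y i / (e / d%:R))).
    by rewrite truncn_le divr_ge0 ?co0// ltW.
  rewrite ler_pdivrMr//; have -> : 2 * B * d%:R * (e / d%:R) = 2 * B * e.
    by field; rewrite gt_eqF.
  exact: co1.
have fn k : (Num.truncn (co y (lift i k) / h) < n.+1)%N.
  rewrite ltnS -(ler_nat R); apply: (@le_trans _ _ (co y (lift i k) / h)).
    by rewrite truncn_le divr_ge0 ?co0// ltW.
  rewrite ler_pdivrMr// /h mulrCA mulfV ?gt_eqF// mulr1; exact: co1.
exists (i, 0 <= (y - x) ord0 i, Ordinal cM, [ffun k => Ordinal (fn k)]).
split => //; split => //.
  by exists x; split => //; rewrite -yx.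
by move=> k; rewrite ffunE.
Qed.

Section HausdorffUpper.
Variables (R : realType) (d : nat).

(** The list is padded with empty sets, whose gauge is 0 even when [m = 0]. *)
Lemma premeasure_le_cover m (T : Type) (s : seq T) (U : T -> set 'rV[R]_d)
    (E : set 'rV[R]_d) (rho delta : R) : 0 <= rho -> rho <= delta ->
  (forall t x y, U t x -> U t y -> enorm (x - y) <= rho) ->
  (forall x, E x -> exists2 i, (i < size s)%N & nth set0 (map U s) i x) ->
  (hausdorff_premeasure m delta E <= ((size s)%:R * rho ^+ m)%:E)%E.
Proof.
move=> rho0 rd hU cov.
pose V := nth set0 (map U s).
have Vdiam k x y : V k x -> V k y -> enorm (x - y) <= rho.
  rewrite /V; elim: s k {cov V} => [|t s ih] [|k] //=; last exact: ih.
  exact: hU.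
apply: le_trans (_ : \sum_(0 <= k <oo) hausdorff_gauge m (V k) <= _)%E.
  apply: ereal_inf_lbound; exists V => //; split.
    by move=> k; apply: ediam_le => [|x y Vx Vy];
      rewrite ?(le_trans (Vdiam _ _ _ Vx Vy))// (le_trans rho0).
  by move=> x /cov[i _ Vi]; exists i.
have gV k : (hausdorff_gauge m (V k) <= (if (k < size s)%N then rho ^+ m else 0)%:E)%E.
  have [ks|ks] := ltnP k (size s); last first.
    by rewrite /V nth_default ?size_map// /hausdorff_gauge eqxx.
  have Vr : (ediam (V k) <= rho%:E)%E by apply: ediam_le => // x y; exact: Vdiam.
  have [rh [rh0 dE hg]] := gauge_fin m Vr.
  have [V0|/eqP/set0P V0] := pselect (V k = set0).
    by rewrite V0 /hausdorff_gauge eqxx lee_fin exprn_ge0.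
  by rewrite hg// lee_fin lerXn2r ?nnegrE// -lee_fin -dE.
apply: lime_le; first by apply: is_cvg_nneseries => k _ _; exact: gauge_ge0.
apply: nearW => n.
apply: (@le_trans _ _ (\sum_(0 <= k < n) (if (k < size s)%N then rho ^+ m else 0)%:E)%E).
  by apply: lee_sum => k _; exact: gV.
rewrite sumEFin lee_fin -big_mkcond/= big_const_seq iter_addr_0.
rewrite -[leLHS]mulr_natl ler_wpM2r ?exprn_ge0// ler_nat.
rewrite -size_filter -[leqRHS](size_iota 0); apply: uniq_leq_size.
  by rewrite filter_uniq// iota_uniq.
by move=> k; rewrite mem_filter mem_iota => /andP[].
Qed.

End HausdorffUpper.

(** * The open set condition *)

Section OpenSetCondition.
Variables (R : realType) (d N : nat).
Variables (S : 'I_N -> 'rV[R]_d -> 'rV[R]_d) (r : 'I_N -> R).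
Variables (K V : set 'rV[R]_d) (v : 'rV[R]_d) (a b : R).

Let A := enum 'I_N.

Hypothesis r0 : forall i, 0 < r i.
Hypothesis r1 : forall i, r i < 1.
Hypothesis simS : forall i, similarity (r i) (S i).
Hypothesis K0 : K !=set0.
Hypothesis cK : compact K.
Hypothesis KE : K = \bigcup_i (S i @` K).
Hypothesis a0 : 0 < a.
Hypothesis Vv : forall x, enorm (x - v) <= a -> V x.
Hypothesis SV : forall i x, V x -> V (S i x).
Hypothesis SVdisj : forall i j x y, V x -> V y -> S i x = S j y -> i = j.
Hypothesis b0 : 0 < b.
Hypothesis Vb : forall x, V x -> enorm (x - v) <= b.
Hypothesis Kb : forall x, K x -> enorm (x - v) <= b.

Let wS := wmap S.
Let W := stop A r.

Lemma selfsim_cover x : K x -> exists2 i, i \in A & exists2 y, K y & x = S i y.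
Proof.
by rewrite {1}KE => -[i _ [y Ky <-]]; exists i; [rewrite mem_enum|exists y].
Qed.

Lemma wmap_selfsim w x : K x -> K (wS w x).
Proof.
by move=> Kx; elim: w => //= i w ih; rewrite KE; exists i => //; exists (wS w x).
Qed.

Lemma word_ball w c (h : R) y : enorm (y - wS w c) <= weight r w * h ->
  exists2 x, wS w x = y & enorm (x - c) <= h.
Proof.
by apply: similarity_ball; [exact: weight_gt0|exact: wmap_similarity].
Qed.

Lemma word_disjoint n e : {in W n e &, forall w w', forall x y, V x -> V y ->
  wS w x = wS w' y -> w = w'}.
Proof.
apply: (stop_disjoint r0 simS (V := V)) => [i x _|i j x y _ _]; [exact: SV|].
exact: SVdisj.
Qed.

Lemma word_ball_disjoint n e (h : R) : h <= a ->
  {in W n e &, forall w w', forall y, enorm (y - wS w v) <= weight r w * h ->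
     enorm (y - wS w' v) <= weight r w' * h -> w = w'}.
Proof.
move=> ha w w' ws w's y /word_ball[x <- xv] /word_ball[x' E x'v].
exact: (word_disjoint ws w's (Vv (le_trans xv ha)) (Vv (le_trans x'v ha)) (esym E)).
Qed.

Lemma weight_expr w n : weight (fun i => r i ^+ n) w = weight r w ^+ n.
Proof. by rewrite /weight prodrXl. Qed.

Lemma wmap_V w x : V x -> V (wS w x).
Proof. by move=> Vx; elim: w => [|i w ih]; [|exact: (@SV i _ ih)]. Qed.

Lemma weight_le1 w : weight r w <= 1.
Proof.
elim: w => [|i w ih]; first by rewrite weight_nil.
by rewrite weight_cons mulr_ile1 ?(ltW (r0 i)) ?(ltW (r1 i)) ?(ltW (weight_gt0 r0 w)).
Qed.

(** The images of one ball of [V] under all words of length [n] are disjoint and stay in a fixed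
    ball. Packing bounds the [n]-th power of the sum by a constant free of [n], which forces the sum
    itself to be at most 1. *)
Lemma sum_ratio_d_le1 : \sum_i r i ^+ d <= 1.
Proof.
apply: (@le1_bounded_expr _ _ ((4 * d.+1%:R * (b + a)) ^+ d / a ^+ d)).
  by apply: sumr_ge0 => i _; rewrite exprn_ge0// ltW.
move=> n; rewrite ler_pdivlMr ?exprn_gt0//.
have := @packing_sum R d _ (W n 0) (fun w => wS w v) (fun w => weight r w * a) v (b + a).
have -> : \sum_(w <- W n 0) (weight r w * a) ^+ d =
    (\sum_i r i ^+ d) ^+ n * a ^+ d.
  rewrite -big_enum/= -(sum_stop0 A r n) mulr_suml; apply: eq_bigr => w _.
  by rewrite weight_expr exprMn.
apply.
- exact: addr_gt0.
- by apply: stop_uniq; exact: enum_uniq.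
- by move=> w _; rewrite mulr_gt0// weight_gt0.
- move=> w _; rewrite lerD//; last by rewrite ler_piMl ?weight_le1// ltW.
  by apply: Vb; apply: wmap_V; apply: Vv; rewrite subrr enorm0 ltW.
- exact: word_ball_disjoint.
Qed.

Lemma dimension_equation : (1 <= N)%N ->
  exists D, [/\ 0 <= D, D <= d%:R & \sum_i r i `^ D = 1].
Proof.
move=> N1; pose f (s : R) := \sum_i r i `^ s.
have f0 : 1 <= f 0.
  rewrite /f; under eq_bigr do rewrite powRr0.
  by rewrite sumr_const card_ord ler1n.
have fd : f d%:R <= 1.
  apply: le_trans sum_ratio_d_le1; apply: ler_sum => i _.
  by rewrite powR_mulrn// ltW.
have cf : {within `[0, d%:R], continuous f}.
  exact/continuous_subspaceT/sum_powR_continuous.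
have [||D] := IVT _ cf (v := 1) => //.
  by rewrite ge_min le_max fd f0 orbT.
rewrite in_itv/= => /andP[D0 Dd] fD; by exists D.
Qed.

(* Each cylinder contains a ball of radius comparable to [e], and these balls
   are disjoint. *)
Lemma overlap (m L : R) : 0 < m -> 0 <= L ->
  exists2 M : R, 0 < M & forall e n p, 0 < e -> calibrated A r m e n ->
    (count (fun w => `[< exists2 x, K x & enorm (wS w x - p) <= L * e >])
       (W n e))%:R <= M.
Proof.
move=> m0 L0; pose C := 4 * d.+1%:R * (b + L + a) / (m * a).
have bLa : 0 < b + L + a by move: a0 b0; lra.
exists (C ^+ d).
  by rewrite exprn_gt0// divr_gt0// ?mulr_gt0.
move=> e n p e0 hn; set P := fun w => _; rewrite -size_filter.
set s := seq.filter P _.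
have ps w : w \in s -> P w /\ w \in W n e by rewrite mem_filter => /andP[].
have h1 w : w \in s -> m * e <= weight r w <= e by move=> /ps[_ /hn].
have : (size s)%:R * (m * e * a) ^+ d <= \sum_(w <- s) (weight r w * a) ^+ d.
  apply: sumr_ge_size => w /h1/andP[h2 _].
  have mea0 : 0 <= m * e * a by rewrite !mulr_ge0// ltW.
  by apply: lerXn2r; rewrite ?nnegrE ?(le_trans mea0)// ler_pM2r.
move=> h2; have h3 : \sum_(w <- s) (weight r w * a) ^+ d <=
    (4 * d.+1%:R * ((b + L + a) * e)) ^+ d.
  apply: (packing_sum (c := fun w => wS w v) (p := p)).
  - by rewrite mulr_gt0.
  - by rewrite filter_uniq// stop_uniq// enum_uniq.
  - by move=> w _; rewrite mulr_gt0// weight_gt0.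
  - move=> w ws; have [/asboolP[x Kx xp] _] := ps _ ws.
    have /andP[_ we] := h1 _ ws; have w0 := weight_gt0 r0 w.
    have t1 := enormB_trans (wS w v) (wS w x) p.
    rewrite (wmap_similarity simS) (enormC v) in t1.
    have t2 : weight r w * enorm (x - v) <= e * b.
      by rewrite ler_pM ?enorm_ge0 ?(ltW w0)// Kb.
    have t3 : weight r w * a <= e * a by rewrite ler_pM2r.
    rewrite mulrDl mulrDl; move: t1 t2 t3 xp; rewrite (mulrC e b) (mulrC e a); lra.
  - move=> w w' /ps[_ ws] /ps[_ w's]; exact: (word_ball_disjoint (lexx a) ws w's).
move: (le_trans h2 h3); rewrite -ler_pdivlMr ?exprn_gt0 ?mulr_gt0// -expr_div_n.
suff -> : 4 * d.+1%:R * ((b + L + a) * e) / (m * e * a) = C by [].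
by rewrite /C; field; rewrite !gt_eqF.
Qed.

Lemma covering_number_bounds D : 0 <= D -> \sum_i r i `^ D = 1 ->
  exists c, exists C, exists2 e0, [/\ 0 < c, 0 < C & 0 < e0] &
    forall e, 0 < e -> e <= e0 ->
      c * e `^ (- D) <= covering_number K e <= C * e `^ (- D).
Proof.
move=> D0 sumD.
have sumDA : \sum_(i <- A) r i `^ D = 1 by rewrite big_enum.
have [m m0 hm] := stopping_length (A := A) r0 (fun i _ => r1 i).
have [M M0 hM] := overlap m0 ler01.
have bb0 : 0 < 2 * b by rewrite mulr_gt0.
exists M^-1, ((m / (2 * b)) `^ (- D)), (Num.min 1 (2 * b)).
  by split; rewrite ?invr_gt0 ?powR_gt0 ?divr_gt0 ?lt_min ?bb0 ?ltr01.
move=> e e0; rewrite le_min => /andP[e1 eb].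
(* As [K] has diameter at most [2 * b], cylinders of ratio [e / (2 * b)] have diameter at most
   [e]. *)
have [||n hn] := hm (e / (2 * b)); first by rewrite divr_gt0.
  by rewrite ler_pdivrMr// mul1r.
pose s := W n (e / (2 * b)).
pose U (i : 'I_(size s)) := wS (nth [::] s i) @` K.
have hU i : (ediam (U i) <= e%:E)%E.
  apply: ediam_le; first exact: ltW.
  move=> _ _ [x Kx <-] [y Ky <-]; rewrite (wmap_similarity simS).
  have /andP[_ we] := hn _ (mem_nth [::] (ltn_ord i)).
  apply: (@le_trans _ _ (e / (2 * b) * (2 * b))); last by rewrite divfK// gt_eqF.
  rewrite ler_pM ?enorm_ge0 ?(ltW (weight_gt0 r0 _))//.
  have := enormB_trans x v y; have := Kb Kx; have := Kb Ky; rewrite (enormC v y); lra.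
have KU : K `<=` \bigcup_i U i.
  move=> x Kx; have [w ws [y Ky ->]] := stop_cover r n (e / (2 * b)) selfsim_cover Kx.
  have wi : (index w s < size s)%N by rewrite index_mem.
  by exists (Ordinal wi) => //; exists y => //; rewrite /= nth_index.
apply/andP; split.
  apply: (covering_number_ge hU KU) => k U' hU' KU'.
  have [n' hn'] := hm _ e0 e1.
  have [x0 Kx0] := K0.
  apply: (@le_trans _ _ (M^-1 * (size (W n' e))%:R)).
    by rewrite ler_pM2l ?invr_gt0//; exact: (stop_size_ge r0 D0 e0 hn' sumDA).
  rewrite ler_pdivrMl//.
  have := @size_le_sum_count _ _ (W n' e) (fun j w => `[< U' j (wS w x0) >]).
  move=> h; apply: le_trans (_ : (\sum_j count (fun w => `[< U' j (wS w x0) >]) (W n' e))%:R <= _).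
    rewrite ler_nat h// => w _; have [j _ Uj] := KU' _ (wmap_selfsim w Kx0).
    by exists j; apply/asboolP.
  rewrite natr_sum; apply: (@le_trans _ _ (\sum_(j < k) M)); last first.
    by rewrite sumr_const card_ord mulr_natr.
  apply: ler_sum => j _.
  have [/hasP[w0 w0s /asboolP Uw0]|hN] := boolP (has (fun w => `[< U' j (wS w x0) >]) (W n' e)); last first.
    by rewrite (_ : count _ _ = 0%N) ?ltW//; apply/eqP; rewrite -leqn0 leqNgt -has_count.
  apply: le_trans (hM e n' (wS w0 x0) e0 hn'); rewrite ler_nat.
  apply: sub_count => w /asboolP Uw; apply/asboolP; exists x0 => //.
  by rewrite mul1r; exact: (ediam_leP (hU' j)).
apply: le_trans (covering_number_le hU KU) _.
have := stop_size_le r0 D0 m0 (divr_gt0 e0 bb0) hn; rewrite sumDA => /(_ (lexx _)).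
move=> /le_trans; apply; rewrite -powRM ?(ltW e0) ?(ltW (divr_gt0 m0 bb0))//.
by rewrite mulrA mulrAC.
Qed.

Lemma minkowski_dimE D : 0 <= D -> \sum_i r i `^ D = 1 -> minkowski_dim K = D.
Proof.
move=> D0 sumD; have [c [C [e0 [c0 C0 e00] h]]] := covering_number_bounds D0 sumD.
apply: cvg_lim; first exact: Rhausdorff.
exact: cvg_ln_ratio h.
Qed.

Lemma ratio_bound : exists q, [/\ 0 <= q, q < 1 & forall i, r i <= q].
Proof.
have [q q0 hq] : exists2 q, 0 < q & forall i, i \in A -> q <= 1 - r i.
  by apply: seq_lower_bound => i _; have := r1 i; lra.
exists (Num.max 0 (1 - q)); split; first by rewrite le_max lexx.
  by rewrite gt_max ltr01 gtrBl.
move=> i; have := hq i (mem_enum _ _); rewrite le_max => h.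
by apply/orP; right; lra.
Qed.

(** * Interior points, local flatness and porosity *)

Hypothesis Vopen : forall x, V x ->
  exists2 h, 0 < h & forall y, enorm (y - x) <= h -> V y.

(* A ball [B] in [V] off all the [S i V] would have disjoint images under all
   words, and at each word length these have the same total volume. *)
Lemma V_dense (eta : R) y : \sum_i r i ^+ d = 1 -> V y -> 0 < eta ->
  exists i z, V z /\ enorm (y - S i z) <= eta.
Proof.
move=> sum1 Vy eta0; apply: contrapT => hN.
have [h' h'0 hV'] := Vopen Vy.
pose h := Num.min h' eta.
have h0 : 0 < h by rewrite lt_min h'0.
pose B := [set u | enorm (u - y) <= h].
have BV : B `<=` V by move=> u uB; apply: hV'; rewrite (le_trans uB)// ge_min lexx.
have gap i z : i \in A -> V z -> ~ B (S i z).
  move=> _ Vz SB; apply: hN; exists i, z; split => //.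
  by rewrite enormC (le_trans SB)// ge_min lexx orbT.
have disj w w' x x' : B x -> B x' -> wS w x = wS w' x' -> w = w'.
  have wA (u : seq 'I_N) : {subset u <= A} by move=> i _; rewrite mem_enum.
  exact: (gap_disjoint r0 simS (fun i z _ => @SV i z)
    (fun i j u u' _ _ => @SVdisj i j u u') BV gap (wA w) (wA w')).
pose C := (4 * d.+1%:R * (b + h)) ^+ d.
suff hn n : n%:R * h ^+ d <= C.
  have := hn (Num.truncn (C / h ^+ d)).+1.
  by rewrite -ler_pdivlMr ?exprn_gt0// leNgt truncnS_gt.
pose s := [seq w | k <- iota 0 n, w <- W k 0].
have -> : n%:R * h ^+ d = \sum_(w <- s) (weight r w * h) ^+ d.
  rewrite big_allpairs_dep/=.
  transitivity (\sum_(k <- iota 0 n) h ^+ d).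
    by rewrite big_const_seq count_predT size_iota iter_addr_0 mulr_natl.
  apply: eq_bigr => k _.
  under eq_bigr do rewrite exprMn -weight_expr.
  by rewrite -mulr_suml (sum_stop0 A r k) big_enum/= sum1 expr1n mul1r.
apply: (packing_sum (c := fun w => wS w y) (p := v)).
- exact: addr_gt0.
- apply: allpairs_uniq_dep; first exact: iota_uniq.
    by move=> k _; apply: stop_uniq; exact: enum_uniq.
  move=> _ _ /allpairsPdep[k [w [_ wk ->]]] /allpairsPdep[k' [w' [_ w'k ->]]] /= ww'.
  have kk' : k = k' by rewrite -(size_stop0 wk) -(size_stop0 w'k) ww'.
  by rewrite -kk' ww'.
- by move=> w _; rewrite mulr_gt0// weight_gt0.
- move=> w _; rewrite lerD//; last by rewrite ler_piMl ?weight_le1// ltW.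
  by apply: Vb; exact: wmap_V.
- move=> w w' _ _ u /word_ball[x <- xB] /word_ball[x' E x'B].
  exact: (disj _ _ _ _ xB x'B (esym E)).
Qed.

(** By [V_dense] a point of [V] is as close as desired to some [S i z] with [z] in [V]. Hence any
    bound on the distance from points of [V] to [K] improves by the factor [q], up to arbitrarily
    small errors, and the distance is 0. *)
Lemma V_subset : \sum_i r i ^+ d = 1 -> V `<=` K.
Proof.
move=> sum1; have [q [q0 q1 rq]] := ratio_bound.
have key n : forall y, V y -> forall eta, 0 < eta ->
    exists2 x, K x & enorm (y - x) <= q ^+ n * (2 * b) + eta.
  elim: n => [|n ih] y Vy eta eta0.
    have [x Kx] := K0; exists x => //.
    have := enormB_trans y v x; have := Vb Vy; have := Kb Kx.
    by rewrite (enormC v x) expr0; lra.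
  have eta2 : 0 < eta / 2 by rewrite divr_gt0.
  have [i [z [Vz zy]]] := V_dense sum1 Vy eta2.
  have [x Kx zx] := ih _ Vz _ eta2.
  exists (S i x); first by rewrite KE; exists i => //; exists x.
  have t1 := enormB_trans y (S i z) (S i x).
  have t2 : enorm (S i z - S i x) <= q * (q ^+ n * (2 * b)) + eta / 2.
    rewrite simS (le_trans (ler_wpM2l (ltW (r0 i)) zx))// mulrDr lerD//.
      by rewrite ler_wpM2r// mulr_ge0 ?exprn_ge0// mulr_ge0// ltW.
    by rewrite ler_piMl ?(ltW eta2)// ltW.
  by rewrite exprS -mulrA; lra.
move=> y Vy; apply: compact_closure => // e e0.
have [|||n qn] := @expr_small _ q (e / (4 * b)) => //.
  by rewrite divr_gt0// mulr_gt0.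
have [|x Kx yx] := key n y Vy (e / 2); first by rewrite divr_gt0.
exists x => //; apply: le_trans yx _.
have : q ^+ n * (2 * b) <= e / (4 * b) * (2 * b) by rewrite ler_pM2r// mulr_gt0.
have -> : e / (4 * b) * (2 * b) = e / 2 by field; rewrite gt_eqF.
lra.
Qed.

Lemma small_cylinder x e : K x -> 0 < e -> exists w y,
  [/\ K y, x = wS w y, weight r w <= e & weight r w * (2 * b) <= e].
Proof.
move=> Kx e0.
have [m m0 hm] := stopping_length (A := A) r0 (fun i _ => r1 i).
have bb0 : 0 < 2 * b by rewrite mulr_gt0.
pose e' := Num.min 1 (Num.min e (e / (2 * b))).
have [||n hn] := hm e'.
- by rewrite !lt_min ltr01 e0 divr_gt0.
- by rewrite ge_min lexx.
have [w /hn/andP[_ we] [y Ky xy]] := stop_cover r n e' selfsim_cover Kx.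
exists w, y; split => //; first by rewrite (le_trans we)// !ge_min lexx !orbT.
by rewrite -ler_pdivlMr// (le_trans we)// !ge_min lexx !orbT.
Qed.

Lemma K_diam x y : K x -> K y -> enorm (x - y) <= 2 * b.
Proof.
move=> Kx Ky; have := enormB_trans x v y; have := Kb Kx; have := Kb Ky.
by rewrite (enormC v y); lra.
Qed.

Lemma interior_locally_flat (x0 : 'rV[R]_d) (h : R) : 0 < h ->
  (forall y, enorm (y - x0) <= h -> K y) -> locally_flat K.
Proof.
move=> h0 hK x Kx e e0.
have e20 : 0 < e / 2 by rewrite divr_gt0.
have [w [y [Ky -> _ we]]] := small_cylinder Kx e20.
have Kx0 : K x0 by apply: hK; rewrite subrr enorm0 ltW.
have w0 := weight_gt0 r0 w.
(* The first entry of the minimum keeps the cube inside the image of the ball, hence in [K]; the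
   second keeps it inside [eball x e]. *)
pose c := wS w x0; pose rho := Num.min (weight r w * h) (e / 2).
have rho0 : 0 < rho by rewrite lt_min e20 mulr_gt0.
pose sg := rho / d.+1%:R; have sg0 : 0 < sg by rewrite divr_gt0.
pose p : 'rV[R]_d := c - const_mx sg.
pose C : set 'rV[R]_d := [set z | forall j, `|z ord0 j - c ord0 j| <= sg].
have Cball z : C z -> enorm (z - c) <= rho.
  move=> Cz; apply: le_trans (_ : d%:R * sg <= _).
    apply: enorm_le_coord => [|j]; first exact: ltW.
    by have := Cz j; rewrite !mxE.
  by rewrite /sg mulrCA ger_pMr// ler_pdivrMr// mul1r ler_nat.
have CK : C `<=` K.
  move=> z /Cball zc; have [|u <- uK] := @word_ball w x0 h z.
    by rewrite (le_trans zc)// ge_min lexx.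
  by apply: wmap_selfsim; exact: hK.
have CKE : C `&` K = C by apply/setIidPl.
have sg20 : 0 < 2 * sg by rewrite mulr_gt0.
exists C; rewrite CKE; split.
- exists (2 * sg), (fun z => p + (2 * sg) *: (z - 0)); split => //.
    exact: affine_similarity.
  apply/seteqP; split => [_ [z zc <-] j|z Cz].
    by have := zc j; rewrite !mxE subr0 ler_norml => /andP[*]; apply/andP; split; nra.
  exists ((2 * sg)^-1 *: (z - p)); last first.
    by rewrite subr0 scalerA mulfV ?gt_eqF// scale1r addrC subrK.
  move=> j; have := Cz j; rewrite !mxE mulrC ler_norml => /andP[*].
  by rewrite divr_ge0 ?ler_pdivrMr ?mul1r ?(ltW sg20)//=; lra.
- move=> z /Cball zc; rewrite /eball/=.
  have t1 := enormB_trans z c (wS w y).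
  have t2 : enorm (c - wS w y) <= e / 2.
    rewrite /c (wmap_similarity simS) (le_trans _ we)// ler_pM2l//.
    exact: K_diam.
  have : rho <= e / 2 by rewrite ge_min lexx orbT.
  lra.
- exists c; split; last exact: wmap_selfsim.
  apply/nbhs_enorm; exists sg => // z zc j.
  by have := enorm_coord (z - c) j; rewrite !mxE => /le_trans; apply.
- exists (2 * sg)^-1, (fun z => 0 + (2 * sg)^-1 *: (z - p)); split.
  + by rewrite invr_gt0.
  + by apply: affine_similarity; rewrite invr_gt0.
  apply/seteqP; split => [_ [z Cz <-] j|z zc].
    have := Cz j; rewrite !mxE add0r mulrC ler_norml => /andP[*].
    by rewrite divr_ge0 ?ler_pdivrMr ?mul1r ?(ltW sg20)//=; lra.
  exists (p + (2 * sg) *: z).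
    move=> j; have := zc j; rewrite !mxE ler_norml => /andP[*].
    by apply/andP; split; nra.
  by rewrite add0r addrC addKr scalerA mulVf ?gt_eqF// scale1r.
Qed.

(** The unit cube is a similar copy of a part of [K], so it is covered by about [e]^ (-
    D)[sets of size comparable to]e[. Then]e [^ (d%:R - D)] stays bounded below as [e] tends to 0,
    which excludes [D < d]. *)
Lemma locally_flat_dim D : locally_flat K -> 0 <= D -> \sum_i r i `^ D = 1 ->
  d%:R <= D.
Proof.
move=> flat D0 sumD; rewrite leNgt; apply/negP => Dd.
have sumDA : \sum_(i <- A) r i `^ D <= 1 by rewrite big_enum/= sumD.
have [x Kx] := K0.
have [C [_ _ _ [rho [T [rho0 simT TE]]]]] := flat x Kx 1 ltr01.
have [m m0 hm] := stopping_length (A := A) r0 (fun i _ => r1 i).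
pose B := 4 * rho * b.
have B0 : 0 < B by rewrite !mulr_gt0.
apply: (@powR_not_bounded_below R (d%:R - D) 1 (m `^ (- D) * B ^+ d) 1) => //.
- by rewrite subr_gt0.
- by rewrite mulr_gt0 ?powR_gt0 ?exprn_gt0.
move=> e e0 e1; have [n hn] := hm _ e0 e1.
have : 1 ^+ d <= \sum_(w <- W n e) (2 * (rho * (2 * b * e))) ^+ d.
  apply: (@covering_sum _ _ _ _ (fun w => [set T z | z in (C `&` K) `&` [set wS w y | y in K]]) _ 0).
  - by [].
  - by move=> w _; rewrite !mulr_gt0.
  - move=> w /hn/andP[_ we] _ _ [_ [_ [x1 Kx1 <-]] <-] [_ [_ [x2 Kx2 <-]] <-] j.
    have := enorm_coord (T (wS w x1) - T (wS w x2)) j; rewrite !mxE => /le_trans; apply.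
    rewrite simT (wmap_similarity simS) ler_pM2l// mulrC.
    rewrite ler_pM ?enorm_ge0 ?(ltW (weight_gt0 r0 w))//.
    exact: K_diam.
  - move=> u hu.
    have : unit_cube u by move=> j; have := hu j; rewrite mxE add0r.
    rewrite -TE => -[z [Cz Kz] <-].
    have [w ws [y Ky zy]] := stop_cover r n e selfsim_cover Kz.
    by exists w => //; exists z => //; split => //; exists y.
rewrite expr1n => /le_trans; apply.
rewrite big_const_seq count_predT iter_addr_0 -[leLHS]mulr_natl.
have -> : 2 * (rho * (2 * b * e)) = B * e by rewrite /B; ring.
apply: le_trans (ler_wpM2r _ (stop_size_le r0 D0 m0 e0 hn sumDA)) _.
  by rewrite exprn_ge0// mulr_ge0// ltW.
rewrite powRM ?(ltW m0) ?(ltW e0)// exprMn -(powR_mulrn _ (ltW e0)).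
rewrite mulrACA -powRD; last by rewrite (gt_eqF e0) implybT.
by rewrite addrC.
Qed.

(** Without holes, [K] is [2 * e]-dense in a cube of size [e / t] about one of its points. There at
    most [M] cylinders of scale [e / t] matter, each splitting into at most [(m * t)]^ (-
    D)[pieces of scale]e[. Comparing volumes bounds]t [^ (d%:R - D)] below for every [t]. *)
Lemma porosity D : 0 <= D -> \sum_i r i `^ D = 1 -> D < d%:R ->
  exists L, exists2 e0, 0 <= L /\ 0 < e0 & forall e x, 0 < e -> e <= e0 -> K x ->
    exists z, enorm (z - x) <= L * e /\ forall y, K y -> 2 * e < enorm (z - y).
Proof.
move=> D0 sumD Dd; apply: contrapT => hN.
have sumDA : \sum_(i <- A) r i `^ D <= 1 by rewrite big_enum/= sumD.
have [m m0 hm] := stopping_length (A := A) r0 (fun i _ => r1 i).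
have d20 : 0 <= d%:R + 2 :> R by rewrite addr_ge0.
have [M M0 hM] := overlap m0 d20.
pose B := 4 + 2 * b; have B0 : 0 < B by rewrite ltr_wpDl// mulr_gt0.
apply: (@powR_not_bounded_below R (d%:R - D) 1 (M * m `^ (- D) * B ^+ d) 1) => //.
- by rewrite subr_gt0.
- by rewrite !mulr_gt0 ?powR_gt0 ?exprn_gt0.
move=> t t0 t1.
(* Failure of the claim for [L = d / t] and [e0 = t]. The bound [e <= t] makes the scale [e / t] at
   most 1, as [stopping_length] requires. *)
have [e [x [e0 et Kx hole]]] : exists e x, [/\ 0 < e, e <= t, K x &
    forall z, enorm (z - x) <= d%:R / t * e -> exists2 y, K y & enorm (z - y) <= 2 * e].
  apply: contrapT => hN'; apply: hN; exists (d%:R / t), t.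
    by rewrite divr_ge0// ltW.
  move=> e x e0 et Kx; apply: contrapT => hN''; apply: hN'; exists e, x; split => //.
  move=> z zx; apply: contrapT => hz; apply: hN''; exists z; split => // y Ky.
  by rewrite ltNge; apply/negP => zy; apply: hz; exists y.
pose rho := e / t; have rho0 : 0 < rho by rewrite divr_gt0.
have rho1 : rho <= 1 by rewrite ler_pdivrMr// mul1r.
have [n1 hn1] := hm _ rho0 rho1.
have [n2 hn2] := hm _ t0 t1.
pose s1 := [seq w <- W n1 rho |
  `[< exists2 y, K y & enorm (wS w y - x) <= (d%:R + 2) * rho >]].
have s1M : (size s1)%:R <= M by rewrite size_filter; exact: hM.
pose s := [seq (w, u) | w <- s1, u <- W n2 t].
have erho : e <= rho by rewrite ler_pdivlMr// ler_piMr// ltW.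
have : (2 * rho) ^+ d <= \sum_(wu <- s) (2 * (B * e)) ^+ d.
  apply: (@covering_sum _ _ _ _ (fun wu => [set z | exists2 y, K y &
     enorm (z - wS (wu.1 ++ wu.2) y) <= 2 * e]) _ (x - const_mx rho)).
  - by rewrite mulr_gt0.
  - by move=> _ _; rewrite mulr_gt0.
  - move=> _ /allpairsP[[w u] /= [ws us ->]] z z' [y Ky zy] [y' Ky' zy'] j.
    have := enorm_coord (z - z') j; rewrite !mxE => /le_trans; apply.
    have t2 : enorm (wS (w ++ u) y - wS (w ++ u) y') <= 2 * b * e.
      rewrite (wmap_similarity simS) weight_cat mulrC.
      rewrite ler_pM ?enorm_ge0 ?K_diam ?mulr_ge0 ?(ltW (weight_gt0 r0 _))//.
      have -> : e = rho * t by rewrite /rho divfK// gt_eqF.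
      rewrite ler_pM ?(ltW (weight_gt0 r0 _))//.
        by move: ws; rewrite mem_filter => /andP[_ /hn1/andP[]].
      by have /andP[] := hn2 _ us.
    have t3 := enormB_trans z (wS (w ++ u) y) z'.
    have t4 := enormB_trans (wS (w ++ u) y) (wS (w ++ u) y') z'.
    by rewrite (enormC (wS (w ++ u) y') z') in t4; move: zy zy'; rewrite /= /B; lra.
  - move=> z zx; have {}zx : enorm (z - x) <= d%:R * rho.
      apply: enorm_le_coord => [|j]; first exact: ltW.
      have := zx j; rewrite !mxE ler_norml => /andP[*].
      by apply/andP; split; lra.
    have [y Ky zy] : exists2 y, K y & enorm (z - y) <= 2 * e.
      by apply: hole; rewrite -mulrA (mulrC _ e).
    have [w ws [y1 Ky1 yy1]] := stop_cover r n1 rho selfsim_cover Ky.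
    have [u us [y2 Ky2 y12]] := stop_cover r n2 t selfsim_cover Ky1.
    exists (w, u); last first.
      by exists y2 => //=; rewrite /wS wmap_cat -y12 -yy1.
    apply: allpairs_f => //; rewrite mem_filter ws andbT; apply/asboolP.
    exists y1 => //; rewrite /wS -yy1.
    by have := enormB_trans y z x; rewrite (enormC y z) mulrDl; lra.
have -> : \sum_(wu <- s) (2 * (B * e)) ^+ d = (size s)%:R * (2 * (B * e)) ^+ d.
  by rewrite big_const_seq count_predT iter_addr_0 [RHS]mulr_natl.
rewrite size_allpairs natrM => h.
have {h} : (2 * rho) ^+ d <= M * (m * t) `^ (- D) * (2 * (B * e)) ^+ d.
  apply: (le_trans h); rewrite ler_wpM2r//; first by rewrite exprn_ge0// !mulr_ge0// ltW.
  by rewrite ler_pM//; exact: (stop_size_le r0 D0 m0 t0 hn2).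
have -> : 2 * (B * e) = B * t * (2 * rho) by rewrite /rho; field; rewrite gt_eqF.
have P0 : 0 < (2 * rho) ^+ d by rewrite exprn_gt0// mulr_gt0.
move=> h; rewrite -(ler_pM2r P0) mul1r; apply: (le_trans h).
rewrite !exprMn powRM ?(ltW m0) ?(ltW t0)// -(powR_mulrn _ (ltW t0)).
have -> : t `^ (d%:R - D) = t `^ d%:R * t `^ (- D).
  by rewrite -powRD// (gt_eqF t0) implybT.
by rewrite le_eqVlt; apply/orP; left; apply/eqP; ring.
Qed.

(** * The boundary of the parallel sets of [K] *)

Lemma parallel_setP y (e : R) :
  parallel_set K e y <-> exists2 x, K x & enorm (y - x) <= e.
Proof.
rewrite /parallel_set/= /edist; split=> [h|[x Kx yx]].
  have [x Kx hx] := compact_nearest y K0 cK; exists x => //.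
  rewrite -lee_fin; apply: le_trans h; apply: le_ereal_inf_tmp => _ [z Kz <-].
  by rewrite lee_fin; exact: hx.
apply: le_trans (_ : (enorm (y - x))%:E <= _)%E; last by rewrite lee_fin.
by apply: ereal_inf_lbound; exists x.
Qed.

(** The premeasure at [delta = e] suffices. For any cover by sets of diameter at most [e],
    [crossing_gauge] yields a multiple of [e ^+ d.-1] near the image of [x0] under each word;
    summing over the words counts each covering set at most [M] times. *)
Lemma boundary_parallel_lower D : (0 < d)%N -> 0 <= D -> \sum_i r i `^ D = 1 ->
  D < d%:R -> exists c, exists2 e0, 0 < c /\ 0 < e0 &
  forall e, 0 < e -> e <= e0 ->
  ((c * e `^ (d%:R - 1 - D))%:E <= curvature_var K e)%E.
Proof.
move=> d0 D0 sumD Dd.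
have sumDA : \sum_(i <- A) r i `^ D = 1 by rewrite big_enum/= sumD.
have dR0 : 0 < d%:R :> R by rewrite ltr0n.
have [L [e0 [L0 e00] por]] := porosity D0 sumD Dd.
have [m m0 hm] := stopping_length (A := A) r0 (fun i _ => r1 i).
(* A crossing lies within [(L + 1) * e] of its word's point, and the covering set meeting it adds
   its diameter, at most [e]. *)
have L20 : 0 <= L + 2 by rewrite addr_ge0.
have [M M0 hM] := overlap m0 L20.
pose om := unit_ball_volume R d.-1 / 2 ^+ d.-1.
have om0 : 0 < om by rewrite divr_gt0 ?unit_ball_volume_gt0// exprn_gt0.
pose c1 := (d%:R^-1 / 4) ^+ d.-1 / 2 : R.
have c10 : 0 < c1 by rewrite divr_gt0// exprn_gt0// divr_gt0// invr_gt0.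
exists (2^-1 * (om * (c1 / M))), (Num.min 1 e0).
  split; last by rewrite lt_min ltr01.
  by apply: mulr_gt0; [rewrite invr_gt0|apply: mulr_gt0 => //; exact: divr_gt0].
move=> e ep; rewrite le_min => /andP[e1 ee0].
have [n hn] := hm _ ep e1.
have [x0 Kx0] := K0.
pose cnt := (size (W n e))%:R : R.
have cntE : e `^ (- D) <= cnt by exact: (stop_size_ge r0 D0 ep hn sumDA).
pose P := parallel_set K e.
suff premeasure_ge : ((cnt * (c1 * e ^+ d.-1) / M)%:E <=
    hausdorff_premeasure d.-1 e (boundary P))%E.
  rewrite /curvature_var /hausdorff_measure -/om -/P.
  apply: (@le_trans _ _ (2^-1%:E * (om%:E * (cnt * (c1 * e ^+ d.-1) / M)%:E))%E).
    have -> : e `^ (d%:R - 1 - D) = e `^ (- D) * e ^+ d.-1.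
      rewrite -(powR_mulrn _ (ltW ep)) -powRD ?(gt_eqF ep) ?implybT//.
      by congr (_ `^ _); rewrite -{1}(prednK d0) -natr1; ring.
    rewrite -!EFinM lee_fin -[leLHS]mulrA ler_pM2l ?invr_gt0//.
    rewrite -[leLHS]mulrA ler_pM2l//.
    have -> : c1 / M * (e `^ (- D) * e ^+ d.-1) = e `^ (- D) * (c1 * e ^+ d.-1 / M).
      by ring.
    rewrite -[leRHS]mulrA ler_wpM2r// mulr_ge0 ?invr_ge0 ?(ltW M0)//.
    by rewrite mulr_ge0 ?exprn_ge0 ?(ltW c10)// ltW.
  apply: lee_wpmul2l; first by rewrite lee_fin.
  apply: lee_wpmul2l; first by rewrite lee_fin ltW.
  apply: (le_trans premeasure_ge); apply: ereal_sup_ubound.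
  by exists e.
apply: le_ereal_inf_tmp => _ [U [hU EU] <-].
have /choice[zf hz] : forall w, exists z, enorm (z - wS w x0) <= L * e /\
    forall y, K y -> 2 * e < enorm (z - y).
  by move=> w; apply: por => //; exact: wmap_selfsim.
pose near w := [set y | enorm (y - wS w x0) <= (L + 1) * e].
pose g w k := (if `[< exists2 y, U k y & near w y >]
  then hausdorff_gauge d.-1 (U k) else 0)%E.
have g0 w k : (0 <= g w k)%E by rewrite /g; case: ifP => // _; exact: gauge_ge0.
pose h := e / d%:R; have h0 : 0 < h by rewrite divr_gt0.
have dh : d%:R * h = e by rewrite /h mulrCA mulfV ?mulr1// gt_eqF.
have local_ge w : ((c1 * e ^+ d.-1)%:E <= \sum_(0 <= k <oo) g w k)%E.
  have [zx zK] := hz w.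
  have -> : c1 * e ^+ d.-1 = (h / 4) ^+ d.-1 / 2.
    by rewrite /c1 mulrAC -exprMn; congr (_ ^+ _ / _); rewrite /h; ring.
  apply: le_trans (@crossing_gauge R d P (wS w x0) (zf w) h e U d0 h0 _ _ hU EU) _.
  - rewrite dh => y yx; apply/parallel_setP; exists (wS w x0) => //.
    exact: wmap_selfsim.
  - rewrite dh => y yz /parallel_setP[x Kx yx]; have := zK x Kx.
    have := enormB_trans (zf w) y x; rewrite (enormC (zf w) y); lra.
  apply: lee_nneseries => [k _ _|k _].
    by case: ifP => // _; exact: gauge_ge0.
  rewrite dh; case: ifP => [/asboolP[y Uy yx]|_]; last exact: g0.
  rewrite /g asboolT//; exists y => //; rewrite /near/=.
  by rewrite mulrDl mul1r (le_trans yx)// lerD2r.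
rewrite -(@lee_pmul2l _ M%:E) ?lte_fin// -EFinM (mulrC M) divfK ?gt_eqF//.
rewrite -nneseriesZl; last by move=> k _; exact: gauge_ge0.
apply: (@le_trans _ _ (\sum_(w <- W n e) \sum_(0 <= k <oo) g w k)%E).
  rewrite /cnt -sum1_size natr_sum mulr_suml -sumEFin.
  by apply: lee_sum => w _; rewrite mul1r; exact: local_ge.
rewrite -nneseries_sum; last by move=> w k _; exact: g0.
apply: lee_nneseries => [k _ _|k _]; first exact: sume_ge0.
rewrite /g -big_mkcond/= -big_filter big_const_seq count_predT.
set cn := size _.
have -> : iter cn (fun x => hausdorff_gauge d.-1 (U k) + x)%E 0%E =
    (cn%:R%:E * hausdorff_gauge d.-1 (U k))%E.
  elim: cn => [|cn ih] /=; first by rewrite mul0e.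
  rewrite ih -natr1 EFinD ge0_muleDl ?lee_fin// mul1e addeC//.
apply: lee_wpmul2r; first exact: gauge_ge0.
rewrite lee_fin /cn size_filter.
have [/hasP[w0 _ /asboolP[y0 Uy0 _]]|hN] :=
    boolP (has (fun w => `[< exists2 y, U k y & near w y >]) (W n e)); last first.
  by rewrite (_ : count _ _ = 0%N) ?ltW//; apply/eqP; rewrite -leqn0 leqNgt -has_count.
apply: le_trans (hM e n y0 ep hn); rewrite ler_nat; apply: sub_count => w.
move=> /asboolP[y Uy yw]; apply/asboolP; exists x0 => //.
have := enormB_trans (wS w x0) y y0; rewrite (enormC (wS w x0) y).
have := ediam_leP (hU k) Uy Uy0; move: yw; rewrite /near/= !mulrDl; lra.
Qed.

Definition frontier := [set x | K x /\
  forall h : R, 0 < h -> exists2 y, enorm (y - x) <= h & ~ K y].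

(** A nearest point [x] of [K] is at distance exactly [e]. It is no interior point of [K], for
    otherwise a small move from [x] towards [y] would give a nearer one. *)
Lemma boundary_parallel y e : 0 < e -> boundary (parallel_set K e) y ->
  (exists2 x, frontier x & enorm (y - x) = e) /\
  (forall x, K x -> e <= enorm (y - x)).
Proof.
move=> e0 [/closure_enorm cy ny].
have [x Kx xmin] := compact_nearest y K0 cK.
have le_e : enorm (y - x) <= e.
  apply/ler_addgt0Pr => h h0; have [y' /parallel_setP[x' Kx' y'x'] y'y] := cy h h0.
  rewrite (le_trans (xmin _ Kx'))// (le_trans (enormB_trans y y' x'))//.
  by rewrite enormC addrC lerD.
have ge_e : e <= enorm (y - x).
  rewrite leNgt; apply/negP => lt_e; apply: ny.
  apply/nbhs_enorm; exists (e - enorm (y - x)); first by rewrite subr_gt0.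
  move=> y' y'y; apply/parallel_setP; exists x => //.
  by rewrite (le_trans (enormB_trans y' y x))//; lra.
have E : enorm (y - x) = e by apply/eqP; rewrite eq_le le_e.
split; last by move=> x' Kx'; rewrite (le_trans ge_e)// xmin.
exists x => //; split => // h h0; apply: contrapT => hN.
pose t := Num.min (h / e) 1.
have t0 : 0 < t by rewrite lt_min divr_gt0// ltr01.
have t1 : t <= 1 by rewrite ge_min lexx orbT.
have Kt : K (x + t *: (y - x)).
  apply: contrapT => hK; apply: hN; exists (x + t *: (y - x)) => //.
  rewrite (addrC x) addrK enormZ E gtr0_norm// -ler_pdivlMr//.
  by rewrite ge_min lexx.
have := xmin _ Kt; rewrite opprD addrA E -{1}[y - x]scale1r -scalerBl enormZ E.
rewrite ger0_norm ?subr_ge0// mulrBl mul1r => hle.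
by have := mulr_gt0 t0 e0; lra.
Qed.

(* A cylinder inside the interior of [K] contains no point of [frontier]. *)
Lemma frontier_cover (x0 : 'rV[R]_d) (h : R) : 0 < h ->
  (forall y, enorm (y - x0) <= h -> K y) -> \sum_i r i ^+ d = 1 ->
  exists A' : seq (seq 'I_N), [/\ forall w, w \in A' -> weight r w < 1,
    \sum_(w <- A') weight r w ^+ d < 1 &
    forall x, frontier x -> exists2 w, w \in A' &
       exists2 y, frontier y & x = wS w y].
Proof.
move=> h0 hK sum1.
have Kx0 : K x0 by apply: hK; rewrite subrr enorm0 ltW.
have [m m0 hm] := stopping_length (A := A) r0 (fun i _ => r1 i).
have bb0 : 0 < 2 * b by rewrite mulr_gt0.
(* The bound 1/2 makes all ratios smaller than 1; the other bound keeps the cylinder through [x0]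
   within [h / 2] of it, leaving a margin [h / 2] inside [K]. *)
pose e := Num.min 2^-1 (h / 2 / (2 * b)).
have [||n hn] := hm e.
- by rewrite lt_min invr_gt0 ltr0Sn !divr_gt0.
- by rewrite ge_min invf_le1// ler1n.
have e1 : e < 1 by rewrite gt_min invf_lt1// ltr1n.
have [w0 w0s [y0 Ky0 x0E]] := stop_cover r n e selfsim_cover Kx0.
have inner y : K y -> ~ frontier (wS w0 y).
  move=> Ky [_ /(_ (h / 2))[]]; first by rewrite divr_gt0.
  move=> z zy; apply; apply: hK.
  have t1 := enormB_trans z (wS w0 y) x0.
  have t2 : enorm (wS w0 y - x0) <= h / 2.
    rewrite x0E (wmap_similarity simS).
    have := hn _ w0s => /andP[_ we].
    apply: (@le_trans _ _ (h / 2 / (2 * b) * (2 * b))); last by rewrite divfK// gt_eqF.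
    rewrite ler_pM ?enorm_ge0 ?K_diam ?(ltW (weight_gt0 r0 _))//.
    by rewrite (le_trans we)// ge_min lexx orbT.
  lra.
exists (seq.filter (predC1 w0) (W n e)); split.
- by move=> w; rewrite mem_filter => /andP[_ /hn/andP[_ /le_lt_trans]]; apply.
- have : \sum_(w <- W n e) weight r w ^+ d = 1.
    under eq_bigr do rewrite -weight_expr.
    by apply: sum_stop_eq1; rewrite big_enum.
  rewrite (bigID (predC1 w0))/= big_filter => <-.
  rewrite ltrDl (big_rem w0)//= eqxx/= ltr_pwDl ?exprn_gt0 ?weight_gt0//.
  by apply: sumr_ge0 => w _; rewrite exprn_ge0// ltW ?weight_gt0.
move=> x [Kx xF]; have [w ws [y Ky xy]] := stop_cover r n e selfsim_cover Kx.
have yF : frontier y.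
  split => // g g0; have w_gt0 := weight_gt0 r0 w.
  have [z zx Kz] := xF _ (mulr_gt0 w_gt0 g0).
  rewrite xy in zx; have [z' z'E z'y] := word_ball zx.
  by exists z' => // Kz'; apply: Kz; rewrite -z'E; exact: wmap_selfsim.
exists w; last by exists y.
rewrite mem_filter ws andbT /=; apply/eqP => ww0; apply: (inner y Ky).
have -> : wS w0 y = x by rewrite xy -ww0.
by split.
Qed.

Lemma curvature_upper (x0 : 'rV[R]_d) (h : R) : (0 < d)%N -> 0 < h ->
  (forall y, enorm (y - x0) <= h -> K y) -> \sum_i r i ^+ d = 1 ->
  exists t C, [/\ 0 <= t, t < d%:R & forall e, 0 < e -> e <= 1 ->
    (curvature_var K e <= (C * e `^ (d%:R - 1 - t))%:E)%E].
Proof.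
move=> d0 h0 hK sum1.
have dR0 : 0 < d%:R :> R by rewrite ltr0n.
have [A' [A'1 sumA' covF]] := frontier_cover h0 hK sum1.
have Kx0 : K x0 by apply: hK; rewrite subrr enorm0 ltW.
have w0 (w : seq 'I_N) : 0 < weight r w by exact: weight_gt0.
have [|t [t0 td sumt]] := @sum_powR_le1_below R _ A' (weight r) d%:R w0 dR0.
  by under eq_bigr do rewrite powR_mulrn ?(ltW (w0 _))//.
have simw w : similarity (weight r w) (wS w) by exact: wmap_similarity.
(* The words of [A'] now act as letters, with ratio [weight r w] and map [wS w]; the strict
   inequality for [d] has already yielded an exponent [t < d] for them. *)
have [m m0 hm] := stopping_length (A := A') w0 A'1.
(* A boundary point is within [e] of its copy of the frontier, which lies within [2 * b * e] of the
   image of [x0]. *)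
have B0 : 0 < 1 + 2 * b by rewrite ltr_wpDr// mulr_ge0// ltW.
have [C C0 hC] := local_cover d0 B0.
pose om := unit_ball_volume R d.-1 / 2 ^+ d.-1.
have om0 : 0 < om by rewrite divr_gt0 ?unit_ball_volume_gt0// exprn_gt0.
exists t, (2^-1 * (om * (m `^ (- t) * C))); split => // e e0 e1.
have [n hn] := hm _ e0 e1.
pose W' := stop A' (weight r) n e.
pose T := wmap wS.
have sizeW : (size W')%:R <= (m * e) `^ (- t) by exact: stop_size_le.
suff pre delta : 0 < delta ->
    (hausdorff_premeasure d.-1 delta (boundary (parallel_set K e)) <=
      (m `^ (- t) * C * e `^ (d%:R - 1 - t))%:E)%E.
  rewrite /curvature_var /hausdorff_measure -/om.
  set Y := m `^ (- t) * C in pre *; set Z := e `^ (d%:R - 1 - t) in pre *.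
  have -> : 2^-1 * (om * Y) * Z = 2^-1 * (om * (Y * Z)) by ring.
  rewrite (EFinM 2^-1) (EFinM om).
  apply: lee_wpmul2l; first by rewrite lee_fin.
  apply: lee_wpmul2l; first by rewrite lee_fin ltW.
  by apply: ge_ereal_sup => _ [delta delta0 <-]; exact: pre.
move=> delta0; have [rho [J [rho0 rd cardJ hJ]]] := hC e delta e0 delta0.
(* Membership of [w] is put into the set, so that covers can be chosen for all words at once, [E w]
   being empty for the others. *)
pose E w := [set y | [/\ w \in W', boundary (parallel_set K e) y &
   exists2 z, frontier z & enorm (y - T w z) = e]].
have /choice[U hU] : forall w, exists U : J -> set 'rV[R]_d,
    (forall j y y', U j y -> U j y' -> enorm (y - y') <= rho) /\
    (forall y, E w y -> exists j, U j y).
  move=> w; apply: (hJ K (T w x0)).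
    move=> y [ws _ [z [Kz _] yz]].
    have Kw : K (T w z) by rewrite /T; elim: w {ws yz} => //= v' w; exact: wmap_selfsim.
    split; last by exists (T w z).
    rewrite (le_trans (enormB_trans y (T w z) (T w x0)))// yz mulrDl mul1r lerD2l.
    rewrite (wmap_similarity simw) mulrC.
    have /andP[_ we] := hn _ ws.
    by rewrite ler_pM ?enorm_ge0 ?K_diam// ltW// weight_gt0.
  by move=> y x [_ /(boundary_parallel e0)[_ h1] _]; exact: h1.
pose s := [seq (w, j) | w <- W', j <- enum J].
have := @premeasure_le_cover R d d.-1 _ s (fun wj => U wj.1 wj.2)
  (boundary (parallel_set K e)) rho delta rho0 rd.
move=> /(_ _ _)/le_trans; apply.
- by move=> [w j] x y /=; case: (hU w) => + _; exact.
- move=> y By; have [[x Fx yx] _] := boundary_parallel e0 By.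
  have [w ws [z Fz xz]] := stop_cover (weight r) n e covF Fx.
  have [|j Uj] := (hU w).2 y; first by split => //; exists z; rewrite // /T -xz.
  have ps : (w, j) \in s by apply: allpairs_f => //; rewrite mem_enum.
  exists (index (w, j) s); first by rewrite index_mem.
  by rewrite (nth_map (w, j)) ?index_mem// nth_index.
rewrite lee_fin size_allpairs -cardE natrM -mulrA.
apply: (@le_trans _ _ ((m * e) `^ (- t) * (C * e ^+ d.-1))).
  by rewrite ler_pM ?mulr_ge0 ?exprn_ge0.
have -> : e `^ (d%:R - 1 - t) = e `^ (- t) * e ^+ d.-1.
  rewrite -(powR_mulrn _ (ltW e0)) -powRD ?(gt_eqF e0) ?implybT//.
  by congr (_ `^ _); rewrite -{1}(prednK d0) -natr1; ring.
by rewrite powRM ?(ltW m0) ?(ltW e0)// le_eqVlt; apply/orP; left; apply/eqP; ring.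
Qed.

End OpenSetCondition.

(** * Scaling exponent *)

Section ScalingExponent.
Variables (R : realType) (d : nat).
Implicit Types (F : set 'rV[R]_d).

(** For [s < D] the rescaled quantity is at least [c] at every small [e]. Convergence to 0 off a
    null set would put a whole interval []0, a[] into that set, against its positive length. *)
Lemma scaling_exponent_ge F (c e0 D : R) : 0 < c -> 0 < e0 ->
  (forall e, 0 < e -> e <= e0 ->
    ((c * e `^ (d%:R - 1 - D))%:E <= curvature_var F e)%E) ->
  (D%:E <= scaling_exponent F)%E.
Proof.
move=> c0 e00 hF; apply: le_ereal_inf_tmp => _ [s [s0 [N negN cv]] <-].
rewrite lee_fin leNgt; apply/negP => sD.
have c0E : (0%E < c%:E)%E by rewrite lte_fin.
have [g/= g0 hg] := cv _ (open_ereal_lt' c0E).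
pose a := Num.min g (Num.min 1 e0).
have a0 : 0 < a by rewrite !lt_min g0 ltr01.
have aN : `]0, a[%classic `<=` N.
  move=> e /=; rewrite in_itv/= => /andP[ep]; rewrite !lt_min => /and3P[eg e1 ee0].
  apply: contrapT => Ne; have := hg e _ ep Ne.
  rewrite /= sub0r normrN gtr0_norm// => /(_ eg); apply/negP; rewrite -leNgt.
  apply: (@le_trans _ _ ((e `^ (s - (d%:R - 1)))%:E * (c * e `^ (d%:R - 1 - D))%:E)%E).
    rewrite -EFinM lee_fin mulrCA -powRD ?(gt_eqF ep) ?implybT// ler_peMr ?(ltW c0)//.
    rewrite (_ : _ + _ = - (D - s)); last by ring.
    rewrite powRN invf_ge1 ?powR_gt0//.
    apply: (@le_trans _ _ (1 `^ (D - s))); last by rewrite powR1.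
    by rewrite ge0_ler_powR ?nnegrE ?subr_ge0 ?(ltW sD) ?(ltW ep) ?(ltW e1).
  by apply: lee_wpmul2l; [rewrite lee_fin powR_ge0|apply: hF => //; exact: ltW].
have [B [mB B0 NB]] := negN.
have : (lebesgue_measure `]0%R, a[%classic <= lebesgue_measure B)%E.
  by apply: le_measure; rewrite ?inE//; exact: subset_trans aN NB.
by rewrite B0 lebesgue_measure_itv/= lte_fin a0 -EFinD subr0 lee_fin leNgt a0.
Qed.

Lemma scaling_exponent_lt F (C t : R) : 0 <= t -> t < d%:R ->
  (forall e, 0 < e -> e <= 1 ->
    (curvature_var F e <= (C * e `^ (d%:R - 1 - t))%:E)%E) ->
  (scaling_exponent F < d%:R%:E)%E.
Proof.
move=> t0 td hF; pose s := (t + d%:R) / 2.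
have ts : t < s by rewrite /s; lra.
apply: (@le_lt_trans _ _ s%:E); last by rewrite lte_fin /s; lra.
apply: ereal_inf_lbound; exists s => //; split; first by rewrite (le_trans t0)// ltW.
exists set0; first exact: negligible_set0.
suff key : ((e `^ (s - (d%:R - 1)))%:E * curvature_var F e)%E @[e --> 0^'+] --> 0%E.
  by move=> P /key hP; apply: (@filterS _ (0 : R)^'+ _ _ _ _ hP) => e + _; exact.
apply: (@squeeze_cvge R (0 : R)^'+ _ R (cst 0%E) _ (fun e => (C * e `^ (s - t))%:E)).
- near=> e; have e0 : 0 < e by near: e; exact: nbhs_right_gt.
  have e1 : e <= 1 by near: e; exact: nbhs_right_le.
  apply/andP; split.
    apply: mule_ge0; first by rewrite lee_fin powR_ge0.
    apply: mule_ge0; first by rewrite lee_fin.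
    apply: mule_ge0.
      by rewrite lee_fin divr_ge0 ?exprn_ge0// ltW// unit_ball_volume_gt0.
    apply: ereal_sup_ge; exists (hausdorff_premeasure d.-1 1 (boundary (parallel_set F e))).
      by exists 1; rewrite //= ltr01.
    apply: le_ereal_inf_tmp => _ [U _ <-].
    by apply: nneseries_ge0 => k _ _; exact: gauge_ge0.
  apply: le_trans (lee_wpmul2l _ (hF e e0 e1)) _; first by rewrite lee_fin powR_ge0.
  rewrite -EFinM lee_fin mulrCA -powRD ?(gt_eqF e0) ?implybT//.
  by rewrite (_ : s - (d%:R - 1) + (d%:R - 1 - t) = s - t)//; ring.
- exact: cvg_cst.
apply: cvg_EFin; first by near=> e.
have st0 : 0 < s - t by rewrite subr_gt0.
have := @cvgM _ _ (0 : R)^'+ _ (cst C) _ _ _ (cvg_cst C) (powR_cvg0 st0).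
by rewrite mulr0; apply.
Unshelve. all: by end_near. Qed.

End ScalingExponent.

Section BoundedOpenSet.
Variables (R : realType) (d N : nat).

(** The open set is cut down to a ball about the origin that every [S i] maps into itself:
    [B + q * rho < rho] for [rho] beyond [B / (1 - q)]. The summand [enorm v] keeps the chosen point
    inside. *)
Lemma osc_bounded (S : 'I_N -> 'rV[R]_d -> 'rV[R]_d) (r : 'I_N -> R) :
  (forall i, 0 < r i) -> (forall i, r i < 1) -> (forall i, similarity (r i) (S i)) ->
  open_set_condition S -> exists V v b, [/\ V v, 0 < b,
    forall x, V x -> enorm (x - v) <= b,
    forall x, V x -> exists2 h, 0 < h & forall y, enorm (y - x) <= h -> V y &
    (forall i x, V x -> V (S i x)) /\
    (forall i j x y, V x -> V y -> S i x = S j y -> i = j)].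
Proof.
move=> r0 r1 simS [V0 [[v V0v] openV0 SV0 disjV0]].
have [q [q0 q1 rq]] := ratio_bound r1.
pose B := \sum_i enorm (S i 0).
have B0 : 0 <= B by apply: sumr_ge0 => i _; exact: enorm_ge0.
have SB i : enorm (S i 0) <= B.
  by rewrite /B (bigD1 i)//= lerDl; apply: sumr_ge0 => j _; exact: enorm_ge0.
have q10 : 0 < 1 - q by rewrite subr_gt0.
pose rho := B / (1 - q) + enorm v + 1.
have Brho : B < (1 - q) * rho.
  have -> : (1 - q) * rho = B + (1 - q) * (enorm v + 1).
    by rewrite /rho; field; rewrite gt_eqF.
  by rewrite ltrDl mulr_gt0// ltr_wpDl ?enorm_ge0.
have vrho : enorm v < rho.
  by rewrite /rho addrAC ltrDr ltr_wpDl// divr_ge0// ltW.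
have rho0 : 0 < rho by rewrite (le_lt_trans (enorm_ge0 v)).
exists [set x | V0 x /\ enorm x < rho], v, (2 * rho); split => //.
- by rewrite mulr_gt0.
- move=> x [_ xrho]; have := enormD x (- v); rewrite enormN; lra.
- move=> x [V0x xrho].
  have /nbhs_enorm[h h0 hV] : nbhs x V0 by exact: open_nbhs_nbhs.
  exists (Num.min h ((rho - enorm x) / 2)).
    by rewrite lt_min h0 divr_gt0// subr_gt0.
  move=> y; rewrite le_min => /andP[yh yx]; split; first exact: hV.
  by have := enormD (y - x) x; rewrite subrK; lra.
- split=> [i x [V0x xrho]|i j x y [V0x _] [V0y _] E].
    split; first by apply: SV0; exists i => //; exists x.
    have := enormD (S i x - S i 0) (S i 0); rewrite subrK simS subr0 => t1.
    have t2 : r i * enorm x <= q * rho by rewrite ler_pM ?enorm_ge0// ltW.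
    by have := SB i; lra.
  apply/eqP/negPn/negP => ij; have : (S i @` V0 `&` S j @` V0) (S i x).
    by split; [exists x|rewrite E; exists y].
  by rewrite disjV0.
Qed.

End BoundedOpenSet.

Theorem theorem4p8 (R : realType) (d N : nat) (d_gt0 : (0 < d)%N)
    (N_ge2 : (2 <= N)%N)
    (S : 'I_N -> 'rV[R]_d -> 'rV[R]_d) (K : set 'rV[R]_d)
    (S_contr : forall i, contracting_similarity (S i))
    (K_selfsim : self_similar_set S K)
    (K_osc : open_set_condition S) :
  (minkowski_dim K = d%:R <->
     (scaling_exponent K < (minkowski_dim K)%:E)%E) /\
  ((scaling_exponent K < (minkowski_dim K)%:E)%E <-> locally_flat K).
Proof.
have /choice[r hr] := S_contr.
have r0 i : 0 < r i by have [/andP[]] := hr i.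
have r1 i : r i < 1 by have [/andP[]] := hr i.
have simS i : similarity (r i) (S i) by have [] := hr i.
have [K0 cK KE] := K_selfsim.
have [V [v [b1 [Vv b10 Vb1 Vopen [SV SVdisj]]]]] := osc_bounded r0 r1 simS K_osc.
have [b2 b20 Kb2] := compact_enorm_bounded v K0 cK.
have [a a0 Va] := Vopen _ Vv.
pose b := b1 + b2; have b0 : 0 < b by rewrite addr_gt0.
have Vb x : V x -> enorm (x - v) <= b.
  by move=> /Vb1 /le_trans; apply; rewrite lerDl ltW.
have Kb x : K x -> enorm (x - v) <= b.
  by rewrite enormC => /Kb2 /le_trans; apply; rewrite lerDr ltW.
have [D [D0 Dd sumD]] :=
  dimension_equation r0 r1 simS a0 Va SV SVdisj b0 Vb (ltnW N_ge2).
rewrite (minkowski_dimE r0 r1 simS K0 KE a0 Va SV SVdisj b0 Kb D0 sumD).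
(* All three assertions hold when [D = d], and all three fail when [D < d]. *)
have [DE|Dlt] := eqVneq D d%:R.
  have sum1 : \sum_i r i ^+ d = 1.
    rewrite -sumD DE; apply: eq_bigr => i _.
    by rewrite powR_mulrn// ltW.
  have VK := V_subset r0 r1 simS K0 cK KE SV SVdisj b0 Vb Kb Vopen sum1.
  have vK y : enorm (y - v) <= a -> K y by move=> /Va; exact: VK.
  have [t [C [t0 td hC]]] := curvature_upper r0 r1 simS K0 cK KE b0 Kb d_gt0 a0 vK sum1.
  have lt_d := scaling_exponent_lt t0 td hC.
  rewrite DE; split; split => // _.
  exact: (interior_locally_flat r0 r1 simS KE b0 Kb a0 vK).
have {Dlt}Dd' : D < d%:R by rewrite lt_neqAle Dlt.
have [c [e0 [c0 e00] hc]] := boundary_parallel_lower r0 r1 simS K0 cK KE a0 Va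
  SV SVdisj b0 Kb d_gt0 D0 sumD Dd'.
have := scaling_exponent_ge c0 e00 hc; rewrite leNgt => /negP scal_ge.
split; split => //.
- by move=> DE; rewrite DE ltxx in Dd'.
- move=> flat; have := locally_flat_dim r0 r1 simS K0 KE b0 Kb flat D0 sumD.
  by rewrite leNgt Dd'.
Qed.
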